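(* $\mathsf{BIM}\vdash\mathbf{WKL}\leftrightarrow\mathbf{\Sigma}^0_1\text{-}\mathbf{Sep}$. Here $\mathbf{WKL}$ is $\forall\alpha[\forall n[\neg Bar_{2^\omega}(D_{\overline\alpha n})]\rightarrow\exists\gamma\in2^\omega\forall n[\alpha(\overline\gamma n)=0]]$ and $\mathbf{\Sigma}^0_1\text{-}\mathbf{Sep}$ is $\forall\alpha[\neg\exists n\forall i<2[(n,i)\in E_\alpha]\rightarrow\exists\gamma\forall n[(n,\gamma(n))\notin E_\alpha]]$.
   Context: $\mathsf{BIM}$ (Basic Intuitionistic Mathematics) is the following two-sorted first-order theory with intuitionistic logic and equality. Numerical variables $m,n,p,\ldots$ range over $\omega=\{0,1,2,\ldots\}$; function variables $\alpha,\beta,\gamma,\ldots$ range over the set $\omega^\omega$ of infinite sequences of natural numbers. There are a numerical constant $0$, unary function constants $Id,\underline 0,S,K,L$ and a binary function symbol $J$; numerical terms are built from numerical variables and $0$ by applying function symbols and function variables. Axioms: (1) $\forall\alpha\forall\beta[\alpha=\beta\leftrightarrow\forall n[\alpha(n)=\beta(n)]]$; (2) $Id(n)=n$, $S(n)\neq 0$, $S(m)=S(n)\rightarrow m=n$, $\underline 0(n)=0$, $K(J(m,n))=m$, $L(J(m,n))=n$, $J(K(n),L(n))=n$; (3) $\forall\alpha\forall\beta\exists\gamma\forall n[\gamma(n)=\alpha(\beta(n))]$, $\forall\alpha\forall\beta\exists\gamma\forall n[\gamma(n)=J(\alpha(n),\beta(n))]$, $\forall\alpha\forall\beta\exists\gamma\forall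 m\forall n[\gamma(m,0)=\alpha(m)\wedge\gamma(m,S(n))=\beta(m,n,\gamma(m,n))]$, $\forall\alpha[\forall n\exists m[\alpha(n,m)=0]\rightarrow\exists\gamma\forall n[\alpha(n,\gamma(n))=0]]$; (4) induction for all formulas of the language. Here $(m,n):=J(m,n)$, $\alpha(m,n):=\alpha(J(m,n))$, $\alpha(m,n,p):=\alpha(J(J(m,n),p))$, $n':=K(n)$, $n'':=L(n)$. $\mathsf{BIM}$ is tacitly extended (conservatively) by symbols and defining equations for all primitive recursive functions and relations. Subsets of $\omega$ and $\omega^\omega$ are given by formulas; set notation is an abbreviation. $\mathsf{BIM}\vdash A$ means that $A$ is derivable in $\mathsf{BIM}$. Finite sequences are coded by natural numbers: $\langle\,\rangle=0$, $\langle m_0,\ldots,m_{k-1}\rangle=p(k-1)\cdot\prod_{i<k}p(i)^{m_i}-1$ for $k>0$ ($p(0)=2,p(1)=3,\ldots$ the primes); every number codes exactly one finite sequence. $length(s)$ is the length of the sequence coded by $s$ and $s(i)$ its $i$-th entry ($s(i)=0$ if $i\ge length(s)$). $\overline\alpha n=\langle\alpha(0),\ldots,\alpha(n-1)\rangle$. $2^\omega=\{\gamma\mid\forall n[\gamma(n)<2]\}$. $D_\alpha=\{i\mid\alpha(i)\neq0\}$; for a number $a$, $D_a=\{i<length(a)\mid a(i)\neq0\}$. $E_\alpha=\{n\mid\exists p[\alpha(p)=n+1]\}$. $Bar_{\mathcal X}(B)$ means $\forall\gamma\in\mathcal X\exists n[\overline\gamma n\in B]$. *)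

(* Defs.v *)
From Stdlib Require Import List.
From Stdlib Require Vector.
Import Vector.VectorNotations.
Local Open Scope list_scope.

(* [prim k] : (definitions of) the primitive recursive functions of arity k.
   [PRec g h] is the f with f(0,x) = g(x) and f(n+1,x) = h(n, f(n,x), x). *)
Inductive prim : nat -> Type :=
| PZero (k : nat) : prim k
| PSucc : prim 1
| PProj (k : nat) (i : Fin.t k) : prim k
| PComp (k m : nat) (g : prim m) (fs : Vector.t (prim k) m) : prim k
| PRec (k : nat) (g : prim k) (h : prim (S (S k))) : prim (S k).

Arguments PProj {k} i.
Arguments PComp {k m} g fs%_vector.
Arguments PRec {k} g h.

Inductive fconst : Type := CId | CZero | CSucc | CK | CL.

(* Variables are de Bruijn indices, counted separately for the two sorts. *)
Inductive fterm : Type :=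
| FVar (x : nat)
| FConst (c : fconst).

Inductive nterm : Type :=
| NVar (x : nat)
| NZero
| NApp (f : fterm) (t : nterm)
| NJ (t u : nterm)
| NPrim (k : nat) (p : prim k) (ts : Vector.t nterm k).

Arguments NPrim {k} p ts%_vector.

Inductive formula : Type :=
| Bot
| EqN (t u : nterm)
| EqF (f g : fterm)
| And (A B : formula)
| Or (A B : formula)
| Imp (A B : formula)
| AllN (A : formula)
| ExN (A : formula)
| AllF (A : formula)
| ExF (A : formula).

Definition Neg (A : formula) : formula := Imp A Bot.
Definition Iff (A B : formula) : formula := And (Imp A B) (Imp B A).

Declare Scope bim_scope.
Delimit Scope bim_scope with bim.
Bind Scope bim_scope with formula nterm fterm.

Module BIMNotations.
Notation "# i" := (NVar i) (at level 1, i at level 0, format "# i") : bim_scope.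
Notation "$ i" := (FVar i) (at level 1, i at level 0, format "$ i") : bim_scope.
Notation "f @ t" := (NApp f t) (at level 20, right associativity) : bim_scope.
Notation "t == u" := (EqN t u) (at level 70, no associativity) : bim_scope.
Notation "f === g" := (EqF f g) (at level 70, no associativity) : bim_scope.
Notation "A //\\ B" := (And A B) (at level 80, right associativity) : bim_scope.
Notation "A --> B" := (Imp A B) (at level 90, right associativity) : bim_scope.
Notation "A <--> B" := (Iff A B) (at level 95, no associativity) : bim_scope.
End BIMNotations.
Import BIMNotations.
Local Open Scope bim_scope.

Definition NS (t : nterm) : nterm := FConst CSucc @ t.

Definition fsubst (tau : nat -> fterm) (f : fterm) : fterm :=
  match f with
  | FVar x => tau x
  | FConst c => FConst c
  end.

Fixpoint nsubst (sigma : nat -> nterm) (tau : nat -> fterm) (t : nterm) : nterm :=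
  match t with
  | NVar x => sigma x
  | NZero => NZero
  | NApp f u => NApp (fsubst tau f) (nsubst sigma tau u)
  | NJ u v => NJ (nsubst sigma tau u) (nsubst sigma tau v)
  | NPrim p ts => NPrim p (Vector.map (nsubst sigma tau) ts)
  end.

Definition scons {X : Type} (x : X) (sigma : nat -> X) (i : nat) : X :=
  match i with
  | 0 => x
  | S j => sigma j
  end.

Definition nshift (t : nterm) : nterm := nsubst (fun i => #(S i)) FVar t.
Definition nshiftF (t : nterm) : nterm := nsubst NVar (fun i => $(S i)) t.
Definition fshift (f : fterm) : fterm := fsubst (fun i => $(S i)) f.

Fixpoint subst (sigma : nat -> nterm) (tau : nat -> fterm) (A : formula) : formula :=
  match A with
  | Bot => Bot
  | EqN t u => EqN (nsubst sigma tau t) (nsubst sigma tau u)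
  | EqF f g => EqF (fsubst tau f) (fsubst tau g)
  | And A B => And (subst sigma tau A) (subst sigma tau B)
  | Or A B => Or (subst sigma tau A) (subst sigma tau B)
  | Imp A B => Imp (subst sigma tau A) (subst sigma tau B)
  | AllN A => AllN (subst (scons #0 (fun i => nshift (sigma i))) tau A)
  | ExN A => ExN (subst (scons #0 (fun i => nshift (sigma i))) tau A)
  | AllF A => AllF (subst (fun i => nshiftF (sigma i)) (scons $0 (fun i => fshift (tau i))) A)
  | ExF A => ExF (subst (fun i => nshiftF (sigma i)) (scons $0 (fun i => fshift (tau i))) A)
  end.

Definition shiftN (A : formula) : formula := subst (fun i => #(S i)) FVar A.
Definition shiftF (A : formula) : formula := subst NVar (fun i => $(S i)) A.
Definition instN (A : formula) (t : nterm) : formula := subst (scons t NVar) FVar A.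
Definition instF (A : formula) (f : fterm) : formula := subst NVar (scons f FVar) A.

(* [prv T G A] : A is derivable from the hypotheses G and the axioms T; the
   free variables of an axiom are read as universally quantified. *)
Inductive prv (T : formula -> Prop) : list formula -> formula -> Prop :=
| Ax G A : T A -> prv T G A
| Hyp G A : In A G -> prv T G A
| BotE G A : prv T G Bot -> prv T G A
| AndI G A B : prv T G A -> prv T G B -> prv T G (And A B)
| AndE1 G A B : prv T G (And A B) -> prv T G A
| AndE2 G A B : prv T G (And A B) -> prv T G B
| OrI1 G A B : prv T G A -> prv T G (Or A B)
| OrI2 G A B : prv T G B -> prv T G (Or A B)
| OrE G A B C :
    prv T G (Or A B) -> prv T (A :: G) C -> prv T (B :: G) C -> prv T G C
| ImpI G A B : prv T (A :: G) B -> prv T G (Imp A B)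
| ImpE G A B : prv T G (Imp A B) -> prv T G A -> prv T G B
| AllNI G A : prv T (map shiftN G) A -> prv T G (AllN A)
| AllNE G A t : prv T G (AllN A) -> prv T G (instN A t)
| ExNI G A t : prv T G (instN A t) -> prv T G (ExN A)
| ExNE G A C :
    prv T G (ExN A) -> prv T (A :: map shiftN G) (shiftN C) -> prv T G C
| AllFI G A : prv T (map shiftF G) A -> prv T G (AllF A)
| AllFE G A f : prv T G (AllF A) -> prv T G (instF A f)
| ExFI G A f : prv T G (instF A f) -> prv T G (ExF A)
| ExFE G A C :
    prv T G (ExF A) -> prv T (A :: map shiftF G) (shiftF C) -> prv T G C
| EqNRefl G t : prv T G (t == t)
| EqNSubst G A t u : prv T G (t == u) -> prv T G (instN A t) -> prv T G (instN A u)
| EqFRefl G f : prv T G (f === f)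
| EqFSubst G A f g : prv T G (f === g) -> prv T G (instF A f) -> prv T G (instF A g).

Inductive BIM_axiom : formula -> Prop :=
| ax_ext :
    BIM_axiom (AllF (AllF ($1 === $0 <--> AllN ($1 @ #0 == $0 @ #0))))

| ax_Id : BIM_axiom (AllN (FConst CId @ #0 == #0))
| ax_S_neq0 : BIM_axiom (AllN (Neg (NS #0 == NZero)))
| ax_S_inj : BIM_axiom (AllN (AllN (NS #1 == NS #0 --> #1 == #0)))
| ax_zero : BIM_axiom (AllN (FConst CZero @ #0 == NZero))
| ax_KJ : BIM_axiom (AllN (AllN (FConst CK @ NJ #1 #0 == #1)))
| ax_LJ : BIM_axiom (AllN (AllN (FConst CL @ NJ #1 #0 == #0)))
| ax_JKL : BIM_axiom (AllN (NJ (FConst CK @ #0) (FConst CL @ #0) == #0))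

| ax_comp :
    BIM_axiom (AllF (AllF (ExF (AllN ($0 @ #0 == $2 @ $1 @ #0)))))
| ax_pair :
    BIM_axiom (AllF (AllF (ExF (AllN ($0 @ #0 == NJ ($2 @ #0) ($1 @ #0))))))
| ax_rec :
    BIM_axiom (AllF (AllF (ExF (AllN (AllN (
      $0 @ NJ #1 NZero == $2 @ #1 //\\
      $0 @ NJ #1 (NS #0) == $1 @ NJ (NJ #1 #0) ($0 @ NJ #1 #0)))))))
| ax_choice :
    BIM_axiom (AllF (AllN (ExN ($0 @ NJ #1 #0 == NZero)) -->
                     ExF (AllN ($1 @ NJ #0 ($0 @ #0) == NZero))))

| ax_ind A :
    BIM_axiom (instN A NZero //\\
               AllN (A --> subst (scons (NS #0) (fun i => #(S i))) FVar A) -->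
               AllN A)

| ax_PZero k (ts : Vector.t nterm k) :
    BIM_axiom (NPrim (PZero k) ts == NZero)
| ax_PSucc t :
    BIM_axiom (NPrim PSucc [t] == NS t)
| ax_PProj k (i : Fin.t k) ts :
    BIM_axiom (NPrim (PProj i) ts == Vector.nth ts i)
| ax_PComp k m (g : prim m) (fs : Vector.t (prim k) m) ts :
    BIM_axiom (NPrim (PComp g fs) ts == NPrim g (Vector.map (fun f => NPrim f ts) fs))
| ax_PRec0 k (g : prim k) h ts :
    BIM_axiom (NPrim (PRec g h) (NZero :: ts) == NPrim g ts)
| ax_PRecS k (g : prim k) h t ts :
    BIM_axiom (NPrim (PRec g h) (NS t :: ts) ==
               NPrim h (t :: NPrim (PRec g h) (t :: ts) :: ts)%vector).

Definition BIM_derives (A : formula) : Prop := prv BIM_axiom nil A.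

(* A primitive recursive relation is given by a function that vanishes exactly
   where the relation holds. *)

Definition x0 {k} : prim (S k) := PProj Fin.F1.
Definition x1 {k} : prim (S (S k)) := PProj (Fin.FS Fin.F1).
Definition x2 {k} : prim (S (S (S k))) := PProj (Fin.FS (Fin.FS Fin.F1)).
Definition x3 {k} : prim (S (S (S (S k)))) := PProj (Fin.FS (Fin.FS (Fin.FS Fin.F1))).

Definition pS {k} (f : prim k) : prim k := PComp PSucc [f].
Fixpoint pconst {k} (n : nat) : prim k :=
  match n with
  | 0 => PZero k
  | S m => pS (pconst m)
  end.

Definition padd : prim 2 := PRec x0 (pS x1).
Definition pmul : prim 2 := PRec (PZero 1) (PComp padd [x1; x2]).
Definition ppred : prim 1 := PRec (PZero 0) x0.
(* (x, y) |-> x - y, truncated *)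
Definition psub : prim 2 := PComp (PRec x0 (PComp ppred [x1])) [x1; x0].
(* (x, y) |-> x ^ y *)
Definition ppow : prim 2 :=
  PComp (PRec (pconst 1) (PComp pmul [x1; x2])) [x1; x0].
Definition pfact : prim 1 := PRec (pconst 1) (PComp pmul [pS x0; x1]).
(* (c, a, b) |-> if c = 0 then a else b *)
Definition pif : prim 3 := PRec x0 x3.
Definition peq : prim 2 :=
  PComp padd [PComp psub [x0; x1]; PComp psub [x1; x0]].
Definition plt : prim 2 := PComp psub [pS x0; x1].

(* (n, d) |-> n mod d *)
Definition prem : prim 2 :=
  PRec (PZero 1)
    (PComp pif [PComp peq [pS x1; x2]; PZero 3; pS x1]).

(* (n, y) |-> the least x < n with f(x, y) = 0, or n if there is none *)
Definition pleast (f : prim 2) : prim 2 :=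
  PRec (PZero 1)
    (PComp pif [PComp f [x1; x2]; x1; pS x0]).

(* q is prime: 2 <= q, and q - 2 is the least x < q - 2 such that x + 2
   divides q (that is, there is none) *)
Definition pprime : prim 1 :=
  let q2 := PComp psub [x0; pconst 2] in
  PComp padd
    [PComp psub [pconst 2; x0];
     PComp peq [PComp (pleast (PComp prem [x1; pS (pS x0)])) [q2; x0]; q2]].

(* m |-> the least prime q > m, sought below m! + 2 *)
Definition pnextprime : prim 1 :=
  PComp (pleast (PComp padd [PComp plt [x1; x0]; PComp pprime [x0]]))
    [pS (pS (PComp pfact [x0])); x0].

(* p(0) = 2, p(1) = 3, ... *)
Definition pnth_prime : prim 1 := PRec (pconst 2) (PComp pnextprime [x1]).

(* (n, q, N) |-> the greatest e <= n such that q ^ e divides N *)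
Definition pval : prim 3 :=
  PRec (PZero 2)
    (PComp pif [PComp prem [x3; PComp ppow [x2; pS x0]]; pS x0; x1]).

(* (n, N) |-> 1 + the greatest j < n such that p(j) divides N, or 0 if there
   is none *)
Definition ptop : prim 2 :=
  PRec (PZero 1)
    (PComp pif [PComp prem [x2; PComp pnth_prime [x0]]; pS x0; x1]).

(* Decoding of <> = 0 and
   <m_0, ..., m_(k-1)> = p(k-1) * p(0)^m_0 * ... * p(k-1)^m_(k-1) - 1:
   if s codes a sequence of length k > 0, then p(k-1) is the greatest prime
   dividing s + 1, and the exponent of p(i) in s + 1 is m_i for i < k - 1,
   m_i + 1 for i = k - 1 and 0 for i >= k. *)
Definition plength : prim 1 := PComp ptop [pS x0; pS x0].
(* (s, i) |-> s(i) *)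
Definition pentry : prim 2 :=
  PComp psub
    [PComp pval [pS x0; PComp pnth_prime [x1]; pS x0];
     PComp pif [PComp peq [pS x1; PComp plength [x0]]; pconst 1; PZero 2]].

Definition Lt (t u : nterm) : formula := NPrim plt [t; u] == NZero.
Definition len (s : nterm) : nterm := NPrim plength [s].
Definition entry (s i : nterm) : nterm := NPrim pentry [s; i].
Definition Two : nterm := NS (NS NZero).

(* s = <f(0), ..., f(t-1)> *)
Definition IsInit (s : nterm) (f : fterm) (t : nterm) : formula :=
  len s == t //\\ AllN (Lt #0 (nshift t) --> entry (nshift s) #0 == f @ #0).

(* Contextual definition of <f(0), ..., f(t-1)>: the formula A holds of it,
   where #0 is the argument place of A. *)
Definition AtInit (f : fterm) (t : nterm) (A : formula) : formula :=
  ExN (IsInit #0 f (nshift t) //\\ A).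

Definition InCantor (f : fterm) : formula := AllN (Lt (f @ #0) Two).

(* D_a as a formula in #0 *)
Definition Dfin (a : nterm) : formula :=
  Lt #0 (len (nshift a)) //\\ Neg (entry (nshift a) #0 == NZero).

Definition InE (f : fterm) (t : nterm) : formula :=
  ExN (f @ #0 == NS (nshift t)).

(* {n | B(n)} is a bar in Cantor space, where n is #0 in B. The substitution
   moves B under AllF and ExN, its #0 becoming the argument place in AtInit. *)
Definition BarCantor (B : formula) : formula :=
  AllF (InCantor $0 -->
        ExN (AtInit $0 #0 (subst (scons #0 (fun i => #(S (S i)))) (fun i => $(S i)) B))).

Definition WKL : formula :=
  AllF (AllN (AtInit $0 #0 (Neg (BarCantor (Dfin #0)))) -->
        ExF (InCantor $0 //\\ AllN (AtInit $0 #0 ($1 @ #0 == NZero)))).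

Definition Sigma01_Sep : formula :=
  AllF (Neg (ExN (AllN (Lt #0 Two --> InE $0 (NJ #1 #0)))) -->
        ExF (AllN (Neg (InE $1 (NJ #0 ($0 @ #0)))))).

(* Main.v *)
From Stdlib Require Import List Lia Arith FunctionalExtensionality Setoid Morphisms Ring.
From Stdlib Require Vector.
Require Import Defs.
Import Vector.VectorNotations.
Local Open Scope list_scope.
Local Open Scope bim_scope.

(** The equivalence is a statement about a formal calculus, and the proof
    separates the calculus from the mathematics.

    The calculus. Contexts, that is lists of hypotheses, are the worlds of a
    canonical Kripke-Beth model [sem]: an implication looks at all larger
    contexts, and a disjunction or an existential statement has to hold only
    locally ([cov]), that is, it may be used as if one disjunct or one witness
    were given as long as the goal is derivable. Forcing in this model is
    derivability ([sem_iff_prv]); the quantifier cases rest on the fact that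
    a derivation may use a variable fresh for its context. Consequently the
    logical steps of BIM become logical steps of the ambient logic, with
    terms as individuals, and only induction ([sem_ind]) still asks for an
    explicit formula. Provable equality of terms is a congruence ([teq]), and
    composition of primitive recursive functions is computed away
    ([by_unfolding]).

    The arithmetic. Of the coding of finite sequences the argument needs, besides
    a bound on the length ([len_le]), that an entry can be appended to any coded
    sequence ([len_app], [entry_app_last], [entry_app_lt]). The code of <m_0, ..., m_k>, increased
    by one, is the product of the p(j)^m_j for j < k with p(k)^(m_k + 1), and
    its decoding requires Euclid's lemma ([euclid]) and the infinity of the
    primes ([next_spec]).

    WKL implies separation ([wkl_to_sep]). Let a enumerate a set of pairs that
    contains no (n, 0) together with (n, 1). Consider the finite sequences s
    for which a pair (m, s(m)) with m < length(s) is enumerated before stage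
    length(s). Finitely many of them never form a bar: the binary sequence
    that takes the value 1 at m exactly if (m, 0) has been enumerated up to a
    suitable stage avoids all of them. So WKL gives a sequence that avoids all
    such s, and it separates.

    Separation implies WKL ([sep_to_wkl]). Call s barred at depth d if every
    binary extension of s by d bits meets the decidable set D_a. This is
    decidable ([barred_function]), it holds of s at depth d + 1 if and only if
    s is in D_a or both children of s are barred at depth d, and it is
    monotone in d. If the root were barred at some depth, then D_a would have
    a finite part that is a bar ([bd_bound]), against the assumption.
    Enumerate (s, i) as soon as, at some depth, the child i of s is barred and
    the other child is not. Monotonicity makes the sets for i = 0 and for
    i = 1 disjoint, so separation gives a choice g of children. The path that
    follows g from the root is never barred: if the child it takes were
    barred, then the other child would be unbarred at that depth, since
    otherwise s itself would be barred; but then the pair (s, g(s)) would have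
    been enumerated. In particular the path avoids D_a. *)

(** * Terms and substitution *)

Notation "# i" := (NVar i) (at level 1, i at level 0, format "# i") : bim_scope.
Notation "$ i" := (FVar i) (at level 1, i at level 0, format "$ i") : bim_scope.

(** A recursive form of Vector.Forall: it computes on literal vectors. *)
Fixpoint vall {X} (P : X -> Prop) {k} (v : Vector.t X k) : Prop :=
  match v with
  | Vector.nil _ => True
  | Vector.cons _ x _ w => P x /\ vall P w
  end.

(** The generated principle gives no induction hypothesis for the arguments of
    a primitive recursive function. *)
Lemma nterm_nested_ind (P : nterm -> Prop)
  (HV : forall x, P (NVar x)) (H0 : P NZero)
  (HA : forall f t, P t -> P (NApp f t))
  (HJ : forall t u, P t -> P u -> P (NJ t u))
  (HP : forall k (p : prim k) ts, vall P ts -> P (NPrim p ts)) :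
  forall t, P t.
Proof.
fix IH 1; intros [x | | f t | t u | k p ts].
- apply HV.
- exact H0.
- apply HA, IH.
- apply HJ; apply IH.
- apply HP; clear p; induction ts as [|t k ts IHts]; cbn; auto.
Qed.

Lemma map_ext_vall {X Y} (f g : X -> Y) {k} (v : Vector.t X k) :
  vall (fun x => f x = g x) v -> Vector.map f v = Vector.map g v.
Proof. induction v as [|x k v IH]; cbn; intuition congruence. Qed.

Lemma map_id_vall {X} (f : X -> X) {k} (v : Vector.t X k) :
  vall (fun x => f x = x) v -> Vector.map f v = v.
Proof. induction v as [|x k v IH]; cbn; intuition congruence. Qed.

Lemma vall_impl {X} (P Q : X -> Prop) {k} (v : Vector.t X k) :
  (forall x, P x -> Q x) -> vall P v -> vall Q v.
Proof. intros PQ; induction v as [|x k v IH]; cbn; firstorder. Qed.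

Lemma vall_true {X} (P : X -> Prop) {k} (v : Vector.t X k) :
  (forall x, P x) -> vall P v.
Proof. intros HP; induction v as [|x k v IH]; cbn; auto. Qed.

Lemma fsubst_comp tau tau' f :
  fsubst tau (fsubst tau' f) = fsubst (fun i => fsubst tau (tau' i)) f.
Proof. now destruct f. Qed.

Lemma nsubst_comp sigma tau sigma' tau' t :
  nsubst sigma tau (nsubst sigma' tau' t)
  = nsubst (fun i => nsubst sigma tau (sigma' i)) (fun i => fsubst tau (tau' i)) t.
Proof.
induction t using nterm_nested_ind; cbn; f_equal; auto using fsubst_comp.
rewrite Vector.map_map; now apply map_ext_vall.
Qed.

Lemma nsubst_id t : nsubst NVar FVar t = t.
Proof.
induction t using nterm_nested_ind; cbn; f_equal; auto.
- now destruct f.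
- now apply map_id_vall.
Qed.

(** The substitutions that [subst] uses under a binder. *)
Definition upN (sigma : nat -> nterm) := scons #0 (fun i => nshift (sigma i)).
Definition upF (tau : nat -> fterm) := scons $0 (fun i => fshift (tau i)).

Lemma subst_comp A : forall sigma tau sigma' tau',
  subst sigma tau (subst sigma' tau' A)
  = subst (fun i => nsubst sigma tau (sigma' i)) (fun i => fsubst tau (tau' i)) A.
Proof.
induction A; intros; cbn; f_equal; auto using fsubst_comp, nsubst_comp;
  rewrite IHA; f_equal; extensionality i.
1, 2: destruct i as [|i]; cbn; trivial; unfold nshift; rewrite !nsubst_comp; f_equal;
  extensionality j; cbn; now destruct (tau j).
1, 3: unfold nshiftF; rewrite !nsubst_comp; f_equal; extensionality j; cbn; now destruct (tau j).
all: destruct i as [|i]; cbn; trivial; unfold fshift; now rewrite !fsubst_comp.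
Qed.

Lemma scons_eta {X} (s : nat -> X) : scons (s 0) (fun i => s (S i)) = s.
Proof. extensionality i; destruct i; reflexivity. Qed.

Lemma subst_id A : subst NVar FVar A = A.
Proof.
induction A; cbn; rewrite ?nsubst_id; f_equal; auto;
  try (now destruct f); try (now destruct g);
  (transitivity (subst NVar FVar A); [|exact IHA]); f_equal; exact (scons_eta _).
Qed.

Lemma instN_subst A sigma tau t :
  instN (subst (upN sigma) tau A) t = subst (scons t sigma) tau A.
Proof.
unfold instN; rewrite subst_comp; f_equal; extensionality i.
- destruct i as [|i]; cbn; trivial. unfold nshift; rewrite nsubst_comp; apply nsubst_id.
- now destruct (tau i).
Qed.

Lemma instF_subst A sigma tau f :
  instF (subst (fun i => nshiftF (sigma i)) (upF tau) A) f = subst sigma (scons f tau) A.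
Proof.
unfold instF; rewrite subst_comp; f_equal; extensionality i.
- unfold nshiftF; rewrite nsubst_comp; apply nsubst_id.
- destruct i as [|i]; cbn; trivial. unfold fshift; rewrite fsubst_comp; now destruct (tau i).
Qed.

Lemma subst_instN A sigma tau t :
  subst sigma tau (instN A t) = instN (subst (upN sigma) tau A) (nsubst sigma tau t).
Proof.
rewrite instN_subst; unfold instN; rewrite subst_comp; f_equal; extensionality i.
now destruct i.
Qed.

Lemma subst_instF A sigma tau f :
  subst sigma tau (instF A f)
  = instF (subst (fun i => nshiftF (sigma i)) (upF tau) A) (fsubst tau f).
Proof.
rewrite instF_subst; unfold instF; rewrite subst_comp; f_equal; extensionality i.
now destruct i.
Qed.

Lemma subst_shiftN A sigma tau :
  subst (upN sigma) tau (shiftN A) = shiftN (subst sigma tau A).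
Proof.
unfold shiftN; rewrite !subst_comp; f_equal; extensionality i. cbn; now destruct (tau i).
Qed.

Lemma subst_shiftF A sigma tau :
  subst (fun i => nshiftF (sigma i)) (upF tau) (shiftF A) = shiftF (subst sigma tau A).
Proof. unfold shiftF; now rewrite !subst_comp. Qed.

Lemma map_shiftN G sigma tau :
  map (subst (upN sigma) tau) (map shiftN G) = map shiftN (map (subst sigma tau) G).
Proof. rewrite !map_map; apply map_ext; intros A; apply subst_shiftN. Qed.

Lemma map_shiftF G sigma tau :
  map (subst (fun i => nshiftF (sigma i)) (upF tau)) (map shiftF G)
  = map shiftF (map (subst sigma tau) G).
Proof. rewrite !map_map; apply map_ext; intros A; apply subst_shiftF. Qed.

(** * Derivations under weakening and substitution *)

Lemma BIM_axiom_subst A sigma tau : BIM_axiom A -> BIM_axiom (subst sigma tau A).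
Proof.
intros HA; destruct HA; cbn; try constructor.
- replace (subst sigma tau (instN A NZero)) with (instN (subst (upN sigma) tau A) NZero)
    by now rewrite subst_instN.
  replace (subst (scons #0 (fun i => nshift (sigma i))) tau
             (subst (scons (NS #0) (fun i => #(S i))) FVar A))
    with (subst (scons (NS #0) (fun i => #(S i))) FVar (subst (upN sigma) tau A)).
  { exact (ax_ind _). }
  rewrite !subst_comp; f_equal; extensionality i.
  + destruct i as [|i]; cbn; trivial. unfold nshift; rewrite nsubst_comp; reflexivity.
  + cbn; now destruct (tau i).
- rewrite <- (Vector.nth_map (nsubst sigma tau) ts i i eq_refl); constructor.
- rewrite Vector.map_map.
  replace (Vector.map (fun x => nsubst sigma tau (NPrim x ts)) fs)
    with (Vector.map (fun f => NPrim f (Vector.map (nsubst sigma tau) ts)) fs) by reflexivity.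
  constructor.
Qed.

Notation "G ⊢ A" := (prv BIM_axiom G A) (at level 70).

Lemma prv_weak G G' A : G ⊢ A -> incl G G' -> G' ⊢ A.
Proof.
intros H; revert G'; induction H; intros G' I;
  try solve [econstructor; eauto using incl_map].
- apply OrE with A B; auto; [apply IHprv2 | apply IHprv3];
    intros x [->|Hx]; cbn; auto.
- apply ImpI, IHprv; intros x [->|Hx]; cbn; auto.
- apply ExNE with A; auto. apply IHprv2; intros x [->|Hx]; cbn; auto.
  right; revert x Hx; now apply incl_map.
- apply ExFE with A; auto. apply IHprv2; intros x [->|Hx]; cbn; auto.
  right; revert x Hx; now apply incl_map.
Qed.

Lemma prv_subst G A :
  G ⊢ A -> forall sigma tau, map (subst sigma tau) G ⊢ subst sigma tau A.
Proof.
induction 1; intros sigma tau; cbn in *.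
- now apply Ax, BIM_axiom_subst.
- now apply Hyp, in_map.
- apply BotE, IHprv.
- apply AndI; auto.
- eapply AndE1; apply IHprv.
- eapply AndE2; apply IHprv.
- apply OrI1; auto.
- apply OrI2; auto.
- eapply OrE; [apply IHprv1 | apply IHprv2 | apply IHprv3].
- apply ImpI; apply IHprv.
- eapply ImpE; [apply IHprv1 | apply IHprv2].
- apply AllNI; fold (upN sigma). rewrite <- map_shiftN; apply IHprv.
- rewrite subst_instN; apply AllNE, IHprv.
- apply ExNI with (nsubst sigma tau t); fold (upN sigma); rewrite <- subst_instN; apply IHprv.
- eapply ExNE; [apply IHprv1 |]. rewrite <- subst_shiftN, <- map_shiftN; apply IHprv2.
- apply AllFI; fold (upF tau). rewrite <- map_shiftF; apply IHprv.
- rewrite subst_instF; apply AllFE, IHprv.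
- apply ExFI with (fsubst tau f); fold (upF tau); rewrite <- subst_instF; apply IHprv.
- eapply ExFE; [apply IHprv1 |]. rewrite <- subst_shiftF, <- map_shiftF; apply IHprv2.
- apply EqNRefl.
- rewrite subst_instN; apply EqNSubst with (nsubst sigma tau t); auto.
  rewrite <- subst_instN; auto.
- apply EqFRefl.
- rewrite subst_instF; apply EqFSubst with (fsubst tau f); auto.
  rewrite <- subst_instF; auto.
Qed.

(** * Fresh variables *)

Definition agree (n : nat) (sigma sigma' : nat -> nterm) (tau tau' : nat -> fterm) :=
  forall i, i < n -> sigma i = sigma' i /\ tau i = tau' i.

Lemma agree_le n m s s' t t' : n <= m -> agree m s s' t t' -> agree n s s' t t'.
Proof. intros L H i Hi; apply H; lia. Qed.

Lemma fsubst_finite f : exists n, forall s s' t t', agree n s s' t t' ->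
  fsubst t f = fsubst t' f.
Proof.
destruct f as [x|c].
- exists (S x); intros s s' t t' H; cbn; apply (H x); lia.
- now exists 0.
Qed.

Lemma nsubst_finite u : exists n, forall s s' t t', agree n s s' t t' ->
  nsubst s t u = nsubst s' t' u.
Proof.
induction u using nterm_nested_ind.
- exists (S x); intros s s' t t' H; cbn; apply (H x); lia.
- now exists 0.
- destruct IHu as [n IH], (fsubst_finite f) as [m Hf].
  exists (max n m); intros s s' t t' H; cbn; f_equal;
    [eapply Hf | eapply IH]; (eapply agree_le; [|exact H]; lia).
- destruct IHu1 as [n IH1], IHu2 as [m IH2].
  exists (max n m); intros s s' t t' H; cbn; f_equal;
    [eapply IH1 | eapply IH2]; (eapply agree_le; [|exact H]; lia).
- enough (exists n, forall s s' t t', agree n s s' t t' ->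
    Vector.map (nsubst s t) ts = Vector.map (nsubst s' t') ts) as [n Hn].
  { exists n; intros; cbn; f_equal; eauto. }
  clear p; induction ts as [|u k ts IHts]; cbn in *; [now exists 0|].
  destruct H as [[n Hn] H], (IHts H) as [m Hm].
  exists (max n m); intros s s' t t' H'; cbn; f_equal;
    [eapply Hn | eapply Hm]; (eapply agree_le; [|exact H']; lia).
Qed.

Lemma agree_upN n s s' t t' : agree n s s' t t' -> agree n (upN s) (upN s') t t'.
Proof.
intros H i Hi; split; [|now apply H].
destruct i as [|i]; cbn; trivial. now rewrite (proj1 (H i ltac:(lia))).
Qed.

Lemma agree_upF n s s' t t' : agree n s s' t t' ->
  agree n (fun i => nshiftF (s i)) (fun i => nshiftF (s' i)) (upF t) (upF t').
Proof.
intros H i Hi; split; [now rewrite (proj1 (H i Hi))|].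
destruct i as [|i]; cbn; trivial. now rewrite (proj2 (H i ltac:(lia))).
Qed.

(** A formula depends on finitely many variables only; the bound is left
    unspecified, which avoids a definition of free variables. *)
Lemma subst_finite A : exists n, forall s s' t t', agree n s s' t t' ->
  subst s t A = subst s' t' A.
Proof.
induction A.
- now exists 0.
- destruct (nsubst_finite t) as [n Hn], (nsubst_finite u) as [m Hm].
  exists (max n m); intros s s' r r' H; cbn; f_equal;
    [eapply Hn | eapply Hm]; (eapply agree_le; [|exact H]; lia).
- destruct (fsubst_finite f) as [n Hn], (fsubst_finite g) as [m Hm].
  exists (max n m); intros s s' r r' H; cbn; f_equal;
    [eapply Hn | eapply Hm]; (eapply agree_le; [|exact H]; lia).
- destruct IHA1 as [n Hn], IHA2 as [m Hm].
  exists (max n m); intros s s' r r' H; cbn; f_equal;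
    [eapply Hn | eapply Hm]; (eapply agree_le; [|exact H]; lia).
- destruct IHA1 as [n Hn], IHA2 as [m Hm].
  exists (max n m); intros s s' r r' H; cbn; f_equal;
    [eapply Hn | eapply Hm]; (eapply agree_le; [|exact H]; lia).
- destruct IHA1 as [n Hn], IHA2 as [m Hm].
  exists (max n m); intros s s' r r' H; cbn; f_equal;
    [eapply Hn | eapply Hm]; (eapply agree_le; [|exact H]; lia).
- destruct IHA as [n Hn]; exists n; intros; cbn; f_equal; apply Hn; now apply agree_upN.
- destruct IHA as [n Hn]; exists n; intros; cbn; f_equal; apply Hn; now apply agree_upN.
- destruct IHA as [n Hn]; exists n; intros; cbn; f_equal; apply Hn; now apply agree_upF.
- destruct IHA as [n Hn]; exists n; intros; cbn; f_equal; apply Hn; now apply agree_upF.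
Qed.

Lemma subst_finite_list G : exists n, forall s s' t t', agree n s s' t t' ->
  map (subst s t) G = map (subst s' t') G.
Proof.
induction G as [|A G [n Hn]]; [now exists 0|].
destruct (subst_finite A) as [m Hm].
exists (max n m); intros s s' r r' H; cbn; f_equal;
    [eapply Hm | eapply Hn]; (eapply agree_le; [|exact H]; lia).
Qed.

(** Undoes an instantiation with the variable [n], if [n] is fresh. *)
Definition recallN (n i : nat) : nterm := if i =? n then #0 else #(S i).
Definition recallF (n i : nat) : fterm := if i =? n then $0 else $(S i).

Lemma fresh_numvar G B : exists n,
  map (subst (recallN n) FVar) G = map shiftN G /\
  subst (recallN n) FVar (instN B #n) = B.
Proof.
destruct (subst_finite_list G) as [m Hm], (subst_finite B) as [k Hk].
exists (max m k); split.
- apply Hm; intros i Hi; split; trivial. unfold recallN.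
  destruct (Nat.eqb_spec i (max m k)); trivial; lia.
- unfold instN; rewrite subst_comp. transitivity (subst NVar FVar B); [|apply subst_id].
  apply Hk; intros i Hi; split; trivial.
  destruct i as [|i]; cbn; unfold recallN.
  + now rewrite Nat.eqb_refl.
  + destruct (Nat.eqb_spec i (max m k)); trivial; lia.
Qed.

Lemma fresh_funvar G B : exists n,
  map (subst NVar (recallF n)) G = map shiftF G /\
  subst NVar (recallF n) (instF B $n) = B.
Proof.
destruct (subst_finite_list G) as [m Hm], (subst_finite B) as [k Hk].
exists (max m k); split.
- apply Hm; intros i Hi; split; trivial. unfold recallF.
  destruct (Nat.eqb_spec i (max m k)); trivial; lia.
- unfold instF; rewrite subst_comp. transitivity (subst NVar FVar B); [|apply subst_id].
  apply Hk; intros i Hi; split; trivial.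
  destruct i as [|i]; cbn; unfold recallF.
  + now rewrite Nat.eqb_refl.
  + destruct (Nat.eqb_spec i (max m k)); trivial; lia.
Qed.

(** * Contexts as worlds *)

Definition world := list formula.
Definition wprop := world -> Prop.
Notation "a .: s" := (scons a s) (at level 55, right associativity).

(** A premise for all terms, with the context unchanged, replaces the premise
    on an eigenvariable: instantiate it with a fresh variable and rename. *)
Lemma AllNI_terms G B : (forall t, G ⊢ instN B t) -> G ⊢ AllN B.
Proof.
intros H; destruct (fresh_numvar G B) as [n [HG HB]].
apply AllNI; rewrite <- HG, <- HB; now apply prv_subst.
Qed.

Lemma AllFI_terms G B : (forall f, G ⊢ instF B f) -> G ⊢ AllF B.
Proof.
intros H; destruct (fresh_funvar G B) as [n [HG HB]].
apply AllFI; rewrite <- HG, <- HB; now apply prv_subst.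
Qed.

Lemma ExNE_terms G B C :
  G ⊢ ExN B -> (forall t, instN B t :: G ⊢ C) -> G ⊢ C.
Proof.
intros HE H; destruct (fresh_numvar (C :: G) B) as [n [HG HB]].
injection HG as HC HG; apply ExNE with B; trivial.
rewrite <- HG, <- HB at 1; rewrite <- HC; exact (prv_subst _ _ (H _) _ _).
Qed.

Lemma ExFE_terms G B C :
  G ⊢ ExF B -> (forall f, instF B f :: G ⊢ C) -> G ⊢ C.
Proof.
intros HE H; destruct (fresh_funvar (C :: G) B) as [n [HG HB]].
injection HG as HC HG; apply ExFE with B; trivial.
rewrite <- HG, <- HB at 1; rewrite <- HC; exact (prv_subst _ _ (H _) _ _).
Qed.

(** [P] holds locally. Quantifying over the goal [C] is what lets the
    elimination rules of disjunction and existence pass through. *)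
Definition cov (P : wprop) : wprop := fun G => forall (G' : world) C,
  incl G G' -> (forall G'' : world, incl G' G'' -> P G'' -> G'' ⊢ C) -> G' ⊢ C.

Definition pimp (P Q : wprop) : wprop := fun G => forall G' : world, incl G G' -> P G' -> Q G'.

Definition absurd : wprop := fun G => G ⊢ Bot.
Definition pneg (P : wprop) : wprop := pimp P absurd.

Definition teq (G : world) (t u : nterm) : Prop := G ⊢ EqN t u.
Definition feq (G : world) (f g : fterm) : Prop := G ⊢ EqF f g.

(** Forcing. Derivability of atoms is the valuation, and environments of terms
    replace the substitution of terms into formulas. *)
Fixpoint sem (A : formula) (r : nat -> nterm) (s : nat -> fterm) : wprop :=
  match A with
  | Bot => absurd
  | EqN t u => fun G => teq G (nsubst r s t) (nsubst r s u)
  | EqF f g => fun G => feq G (fsubst s f) (fsubst s g)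
  | And A B => fun G => sem A r s G /\ sem B r s G
  | Or A B => cov (fun G => sem A r s G \/ sem B r s G)
  | Imp A B => pimp (sem A r s) (sem B r s)
  | AllN A => fun G => forall t, sem A (t .: r) s G
  | ExN A => cov (fun G => exists t, sem A (t .: r) s G)
  | AllF A => fun G => forall f, sem A r (f .: s) G
  | ExF A => cov (fun G => exists f, sem A r (f .: s) G)
  end.

Class Mono (P : wprop) : Prop := mono : forall G G' : world, incl G G' -> P G -> P G'.
(** The properties of worlds that can be proved by working locally. All
    formulas have it; disjunction and existence in the ambient logic do not. *)
Class Local (P : wprop) : Prop := local : forall G, cov P G -> P G.

Lemma cov_ret (P : wprop) {M : Mono P} G : P G -> cov P G.
Proof. intros H G' C I K; apply K; [apply incl_refl|]. exact (mono _ _ I H). Qed.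

(** The rule for using a local hypothesis, at the price of a larger world. *)
Lemma local_bind (P Q : wprop) {L : Local Q} G :
  cov P G -> (forall G' : world, incl G G' -> P G' -> Q G') -> Q G.
Proof.
intros H K; apply local; intros G' C I K'; apply H; trivial.
intros G'' I' p; apply K'; trivial. apply K; trivial. now apply incl_tran with G'.
Qed.

Lemma pimp_app (P Q : wprop) G : pimp P Q G -> P G -> Q G.
Proof. intros H; apply H, incl_refl. Qed.

(* Instances are stated for abstractions over the world, so that one shape is
   matched by unification; other goals are first expanded to that shape. *)
#[export] Hint Extern 0 (Mono ?P) =>
  lazymatch P with fun _ => _ => fail | _ => change (Mono (fun G => P G)) end : typeclass_instances.
#[export] Hint Extern 0 (Local ?P) =>
  lazymatch P with fun _ => _ => fail | _ => change (Local (fun G => P G)) end : typeclass_instances.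

#[export] Instance mono_prv A : Mono (fun G => G ⊢ A).
Proof. intros G G' I H; now apply prv_weak with G. Qed.
#[export] Instance mono_teq t u : Mono (fun G => teq G t u).
Proof. apply mono_prv. Qed.
#[export] Instance mono_feq t u : Mono (fun G => feq G t u).
Proof. apply mono_prv. Qed.
#[export] Instance mono_absurd : Mono (fun G => absurd G).
Proof. apply mono_prv. Qed.
#[export] Instance mono_incl G0 : Mono (fun G => incl G0 G).
Proof. intros G G' I H; now apply incl_tran with G. Qed.
#[export] Instance mono_cov P : Mono (fun G => cov P G).
Proof. intros G G' I H G'' C I' K; apply H; trivial. now apply incl_tran with G'. Qed.
#[export] Instance mono_pimp P Q : Mono (fun G => pimp P Q G).
Proof. intros G G' I H G'' I' p; apply H; trivial. now apply incl_tran with G'. Qed.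
#[export] Instance mono_pneg P : Mono (fun G => pneg P G).
Proof. apply mono_pimp. Qed.
#[export] Instance mono_and P Q :
  Mono (fun G => P G) -> Mono (fun G => Q G) -> Mono (fun G => P G /\ Q G).
Proof. intros M N G G' I [p q]; split; [now apply (M G) | now apply (N G)]. Qed.
#[export] Instance mono_or P Q :
  Mono (fun G => P G) -> Mono (fun G => Q G) -> Mono (fun G => P G \/ Q G).
Proof. intros M N G G' I [p|q]; [left; now apply (M G) | right; now apply (N G)]. Qed.
#[export] Instance mono_all {X} (P : X -> wprop) :
  (forall x, Mono (fun G => P x G)) -> Mono (fun G => forall x, P x G) | 10.
Proof. intros M G G' I p x; now apply (M x G). Qed.
#[export] Instance mono_ex {X} (P : X -> wprop) :
  (forall x, Mono (fun G => P x G)) -> Mono (fun G => exists x, P x G).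
Proof. intros M G G' I [x p]; exists x; now apply (M x G). Qed.

#[export] Instance local_prv A : Local (fun G => G ⊢ A).
Proof. intros G H; apply H; auto using incl_refl. Qed.
#[export] Instance local_teq t u : Local (fun G => teq G t u).
Proof. apply local_prv. Qed.
#[export] Instance local_feq t u : Local (fun G => feq G t u).
Proof. apply local_prv. Qed.
#[export] Instance local_absurd : Local (fun G => absurd G).
Proof. apply local_prv. Qed.
#[export] Instance local_cov P : Local (fun G => cov P G).
Proof.
intros G H G' C I K; apply H; trivial. intros G'' I' p; apply p; [apply incl_refl|].
intros G3 I3; apply K; now apply incl_tran with G''.
Qed.
#[export] Instance local_pimp P Q :
  Mono (fun G => P G) -> Local (fun G => Q G) -> Local (fun G => pimp P Q G).
Proof.
intros M L G H G' I p; apply (L G'); intros G1 C I1 K; apply (mono _ _ I H); trivial.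
intros G'' I'' i; apply K; trivial.
apply pimp_app with P; trivial. apply (M G'); trivial. now apply incl_tran with G1.
Qed.
#[export] Instance local_pneg P : Mono (fun G => P G) -> Local (fun G => pneg P G).
Proof. intros M; apply local_pimp; [exact M | apply local_absurd]. Qed.
#[export] Instance local_and P Q :
  Local (fun G => P G) -> Local (fun G => Q G) -> Local (fun G => P G /\ Q G).
Proof.
intros M N G H; split.
- apply (M G); intros G' C I K; apply H; trivial; intros G'' I' [p q]; now apply K.
- apply (N G); intros G' C I K; apply H; trivial; intros G'' I' [p q]; now apply K.
Qed.
#[export] Instance local_all {X} (P : X -> wprop) :
  (forall x, Local (fun G => P x G)) -> Local (fun G => forall x, P x G) | 10.
Proof. intros M G H x; apply (M x); intros G' C I K; apply H; auto. Qed.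

#[export] Instance mono_sem A : forall r s, Mono (fun G => sem A r s G).
Proof.
induction A; intros r s; cbn; exact _.
Qed.
#[export] Instance local_sem A : forall r s, Local (fun G => sem A r s G).
Proof.
induction A; intros r s; cbn; exact _.
Qed.

(** Carries all hypotheses at the world [G] over to the larger world [G'],
    which afterwards takes the name of [G]. *)
Ltac lift_hyps G G' I :=
  repeat match goal with
  | H : ?T |- _ =>
    lazymatch H with I => fail | _ => idtac end;
    lazymatch T with context [G] => idtac end;
    let P := eval pattern G in T in
    lazymatch P with ?F _ =>
      let H' := fresh in
      pose proof (mono (P := F) G G' I H) as H'; cbv beta in H'; clear H; rename H' into H
    end
  end;
  try (clear I G; rename G' into G).

(** [open H as p] uses the local hypothesis [H], and [assume p] introduces the
    premise of an implication. *)
Tactic Notation "open" constr(H) "as" simple_intropattern(p) :=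
  lazymatch type of H with
  | cov _ ?G =>
    pattern G;
    lazymatch goal with |- ?Q G =>
      let G' := fresh G in let I := fresh "I" in
      apply (local_bind _ Q G H); intros G' I; cbv beta; try clear H; lift_hyps G G' I
    end
  end; intros p.

Tactic Notation "assume" simple_intropattern(p) :=
  try match goal with |- pneg _ _ => unfold pneg end;
  lazymatch goal with |- pimp _ _ ?G =>
    let G' := fresh G in let I := fresh "I" in intros G' I; cbv beta; lift_hyps G G' I
  end; intros p.

(** Forcing gives derivability of a disjunction or an existential formula because
    derivability is a local property; conversely, the disjuncts or an instance
    are added to the context, which is a larger world where they are forced. The
    premise of an implication is treated in the same way. *)
Theorem sem_iff_prv A : forall r s G, sem A r s G <-> G ⊢ subst r s A.
Proof.
induction A; intros r s G; cbn [sem subst].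
- reflexivity.
- reflexivity.
- reflexivity.
- rewrite IHA1, IHA2; split; [now intros []; apply AndI|].
  intros H; split; [now apply AndE1 in H | now apply AndE2 in H].
- split.
  + intros H; apply (local_bind _ (fun G => G ⊢ _) _ H); intros G' I [p|p].
    * now apply OrI1, IHA1.
    * now apply OrI2, IHA2.
  + intros H G' C I K; eapply OrE; [eapply prv_weak; eassumption | |];
      apply K; auto using incl_tl, incl_refl.
    * left; apply IHA1, Hyp; now left.
    * right; apply IHA2, Hyp; now left.
- split.
  + intros H; apply ImpI, IHA2, H; [auto using incl_tl, incl_refl|].
    apply IHA1, Hyp; now left.
  + intros H G' I p; apply IHA2; apply ImpE with (subst r s A1); [|now apply IHA1].
    now apply prv_weak with G.
- fold (upN r); split.
  + intros H; apply AllNI_terms; intros t; rewrite instN_subst; apply IHA, H.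
  + intros H t; apply IHA; rewrite <- instN_subst; now apply AllNE.
- fold (upN r); split.
  + intros H; apply (local_bind _ (fun G => G ⊢ _) _ H); intros G' I [t p].
    apply ExNI with t; rewrite instN_subst; now apply IHA.
  + intros H G' C I K; apply ExNE_terms with (subst (upN r) s A);
      [now apply prv_weak with G|]. intros t; apply K; [auto using incl_tl, incl_refl|].
    exists t; apply IHA, Hyp; rewrite instN_subst; now left.
- fold (upF s); split.
  + intros H; apply AllFI_terms; intros t; rewrite instF_subst; apply IHA, H.
  + intros H t; apply IHA; rewrite <- instF_subst; now apply AllFE.
- fold (upF s); split.
  + intros H; apply (local_bind _ (fun G => G ⊢ _) _ H); intros G' I [t p].
    apply ExFI with t; rewrite instF_subst; now apply IHA.
  + intros H G' C I K; apply ExFE_terms with (subst (fun i => nshiftF (r i)) (upF s) A);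
      [now apply prv_weak with G|]. intros t; apply K; [auto using incl_tl, incl_refl|].
    exists t; apply IHA, Hyp; rewrite instF_subst; now left.
Qed.

Lemma sem_of_prv A G : G ⊢ A -> sem A NVar FVar G.
Proof. rewrite <- (subst_id A) at 1; apply sem_iff_prv. Qed.

Lemma prv_of_sem A G : sem A NVar FVar G -> G ⊢ A.
Proof. rewrite <- (subst_id A) at 2; apply sem_iff_prv. Qed.

Lemma sem_axiom A G : BIM_axiom A -> sem A NVar FVar G.
Proof. intros H; now apply sem_of_prv, Ax. Qed.

Lemma nsubst_shift t x r : nsubst (x .: NVar) r (nshift t) = nsubst NVar r t.
Proof. unfold nshift; rewrite nsubst_comp; reflexivity. Qed.

(** Induction in BIM, for predicates given by a formula with parameters. *)
Lemma sem_ind A r s G :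
  sem A (NZero .: r) s G ->
  (forall (G' : world) t, incl G G' -> sem A (t .: r) s G' -> sem A (NS t .: r) s G') ->
  forall t, sem A (t .: r) s G.
Proof.
intros H0 HS; set (B := subst (upN r) s A).
assert (HB : forall t G', sem A (t .: r) s G' <-> G' ⊢ instN B t).
{ intros t G'; unfold B; rewrite instN_subst; apply sem_iff_prv. }
intros t; apply HB, AllNE, ImpE with (1 := Ax _ _ _ (ax_ind B)), AndI; [now apply HB|].
apply AllNI_terms; intros u.
replace (instN _ u) with (Imp (instN B u) (instN B (NS u))).
- apply ImpI, HB, HS; [auto using incl_tl, incl_refl|]. apply HB, Hyp; now left.
- unfold instN; cbn [subst]; f_equal; rewrite subst_comp; f_equal.
  now extensionality i; destruct i.
Qed.

(** * Equality of terms *)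

#[export] Instance teq_equiv G : Equivalence (teq G).
Proof.
split.
- intros t; apply EqNRefl.
- intros t u H. assert (K : G ⊢ instN (EqN #0 (nshift t)) u).
  { apply EqNSubst with t; trivial. unfold instN; cbn; rewrite nsubst_shift, nsubst_id. apply EqNRefl. }
  unfold instN in K; cbn in K; now rewrite nsubst_shift, nsubst_id in K.
- intros t u v H H'. assert (K : G ⊢ instN (EqN (nshift t) #0) v).
  { apply EqNSubst with u; trivial. unfold instN; cbn; now rewrite nsubst_shift, nsubst_id. }
  unfold instN in K; cbn in K; now rewrite nsubst_shift, nsubst_id in K.
Qed.

(** Replacement in one argument place of an arbitrary term. *)
Lemma teq_hole G c a b : teq G a b ->
  teq G (nsubst (a .: NVar) FVar c) (nsubst (b .: NVar) FVar c).
Proof.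
intros H. assert (K : G ⊢ instN (EqN (nshift (nsubst (a .: NVar) FVar c)) c) b).
{ apply EqNSubst with a; trivial. unfold instN; cbn; rewrite nsubst_shift, nsubst_id.
  apply EqNRefl. }
unfold instN in K; cbn in K; now rewrite nsubst_shift, nsubst_id in K.
Qed.

#[export] Instance NApp_proper G f : Proper (teq G ==> teq G) (NApp f).
Proof. intros a b H. generalize (teq_hole G (NApp f #0) a b H); cbn; now destruct f. Qed.
#[export] Instance NS_proper G : Proper (teq G ==> teq G) NS.
Proof. apply NApp_proper. Qed.
#[export] Instance NJ_proper G : Proper (teq G ==> teq G ==> teq G) NJ.
Proof.
intros a b H c d K; transitivity (NJ b c).
- generalize (teq_hole G (NJ #0 (nshift c)) a b H); cbn; now rewrite !nsubst_shift, nsubst_id.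
- generalize (teq_hole G (NJ (nshift b) #0) c d K); cbn; now rewrite !nsubst_shift, nsubst_id.
Qed.

Fixpoint veq (G : world) {k} (ts : Vector.t nterm k) : Vector.t nterm k -> Prop :=
  match ts with
  | Vector.nil _ => fun _ => True
  | Vector.cons _ t _ ts => fun us => teq G t (Vector.hd us) /\ veq G ts (Vector.tl us)
  end.


(** Replacement in finitely many places, one variable at a time. *)
Lemma teq_env G c n : forall r r' : nat -> nterm,
  (forall i, i < n -> teq G (r i) (r' i)) -> (forall i, n <= i -> r i = r' i) ->
  teq G (nsubst r FVar c) (nsubst r' FVar c).
Proof.
induction n as [|n IH]; intros r r' H E.
- replace r' with r; [reflexivity|]. extensionality i; apply E; lia.
- assert (K : forall a, nsubst (fun i => if i =? n then a else r i) FVar c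
    = nsubst (a .: NVar) FVar (nsubst (fun i => if i =? n then #0 else nshift (r i)) FVar c)).
  { intros a; rewrite nsubst_comp; f_equal; extensionality i.
    destruct (i =? n); cbn; trivial. now rewrite nsubst_shift, nsubst_id. }
  transitivity (nsubst (fun i => if i =? n then r' n else r i) FVar c).
  + replace r with (fun i => if i =? n then r n else r i) at 1.
    * rewrite !K; apply teq_hole, H; lia.
    * extensionality i; destruct (Nat.eqb_spec i n); congruence.
  + apply IH; intros i Hi; destruct (Nat.eqb_spec i n) as [->|]; try reflexivity.
    * apply H; lia.
    * apply E; lia.
Qed.

Fixpoint env {k} (v : Vector.t nterm k) : nat -> nterm :=
  match v with
  | Vector.nil _ => NVar
  | Vector.cons _ t _ v => t .: env v
  end.

Fixpoint vars (k m : nat) : Vector.t nterm k :=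
  match k with 0 => Vector.nil _ | S k => Vector.cons _ #m _ (vars k (S m)) end.

Lemma map_env_vars {k} (v : Vector.t nterm k) r m :
  (forall i, r (m + i) = env v i) -> Vector.map (nsubst r FVar) (vars k m) = v.
Proof.
revert m; induction v as [|t k v IH]; intros m H; cbn; trivial; f_equal.
- now specialize (H 0); rewrite Nat.add_0_r in H.
- apply IH; intros i. now specialize (H (S i)); rewrite Nat.add_succ_r in H.
Qed.

Lemma NPrim_cong G {k} (p : prim k) (ts us : Vector.t nterm k) :
  veq G ts us -> teq G (NPrim p ts) (NPrim p us).
Proof.
intros H; rewrite <- (map_env_vars ts (env ts) 0), <- (map_env_vars us (env us) 0) by trivial.
apply (teq_env G (NPrim p (vars k 0)) k); clear p.
- induction ts as [|t k ts IH]; intros i Hi; [lia|].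
  revert H; apply (Vector.caseS' us); intros u us' [Ht H]; destruct i as [|i]; cbn; trivial.
  apply IH; trivial; lia.
- induction ts as [|t k ts IH].
  + intros i _. now apply (Vector.case0 (fun us => env [] i = env us i)).
  + revert H; apply (Vector.caseS' us); intros u us' [Ht H] [|i] Hi; cbn; [lia|].
    apply IH; trivial; lia.
Qed.

(** * Unfolding primitive recursive functions *)

Lemma prim_nested_rect (P : forall k, prim k -> Prop)
  (H0 : forall k, P k (PZero k)) (HS : P 1 PSucc) (HP : forall k i, P k (PProj i))
  (HC : forall k m (g : prim m) (fs : Vector.t (prim k) m),
    P m g -> vall (P k) fs -> P k (PComp g fs))
  (HR : forall k g h, P k g -> P _ h -> P _ (PRec g h)) :
  forall k p, P k p.
Proof.
fix IH 2; intros _ [k | | k i | k m g fs | k g h].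
- apply H0.
- apply HS.
- apply HP.
- apply HC; [apply IH|]. clear g; induction fs as [|f m fs IHfs]; cbn; auto.
- apply HR; apply IH.
Qed.

(** Computes compositions and projections and stops at a recursion. *)
Fixpoint red {k} (p : prim k) : Vector.t nterm k -> nterm :=
  match p in prim k return Vector.t nterm k -> nterm with
  | PZero _ => fun _ => NZero
  | PSucc => fun ts => NS (Vector.hd ts)
  | PProj i => fun ts => Vector.nth ts i
  | PComp g fs => fun ts => red g (Vector.map (fun f => red f ts) fs)
  | PRec g h => fun ts => NPrim (PRec g h) ts
  end.

Fixpoint nred (t : nterm) : nterm :=
  match t with
  | NVar x => NVar x
  | NZero => NZero
  | NApp f u => NApp f (nred u)
  | NJ u v => NJ (nred u) (nred v)
  | NPrim p ts => red p (Vector.map nred ts)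
  end.

Lemma veq_map {X} G (f g : X -> nterm) {k} (v : Vector.t X k) :
  vall (fun x => teq G (f x) (g x)) v -> veq G (Vector.map f v) (Vector.map g v).
Proof. induction v as [|x k v IH]; cbn; intuition. Qed.

Lemma red_sound G {k} (p : prim k) ts : teq G (NPrim p ts) (red p ts).
Proof.
revert ts; induction p as [k | | k i | k m g fs IHg IHfs | k g h _ _] using prim_nested_rect;
  intros ts; cbn.
- apply Ax; constructor.
- rewrite (Vector.eta ts). apply (Vector.case0 (fun v => teq G (NPrim PSucc (Vector.hd ts :: v)) _)).
  apply Ax; constructor.
- apply Ax; constructor.
- rewrite <- IHg. transitivity (NPrim g (Vector.map (fun f => NPrim f ts) fs)).
  + apply Ax; constructor.
  + apply NPrim_cong, veq_map. revert IHfs; apply vall_impl; auto.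
- reflexivity.
Qed.

Lemma nred_sound G t : teq G t (nred t).
Proof.
induction t as [x | | f t IH | t u IHt IHu | k p ts IH] using nterm_nested_ind; cbn.
- reflexivity.
- reflexivity.
- now apply NApp_proper.
- now apply NJ_proper.
- rewrite <- red_sound; apply NPrim_cong. rewrite <- (Vector.map_id _ _ ts) at 1.
  now apply veq_map.
Qed.

(** Two terms with the same normal form are provably equal. As the normal form
    is computed by conversion, this settles every defining equation that
    involves no recursion step. *)
Lemma by_unfolding G t u : nred t = nred u -> teq G t u.
Proof. intros E; rewrite (nred_sound G t), (nred_sound G u), E; reflexivity. Qed.

Lemma rec_zero G {k} (g : prim k) h ts : teq G (NPrim (PRec g h) (NZero :: ts)) (NPrim g ts).
Proof. apply Ax; constructor. Qed.

Lemma rec_succ G {k} (g : prim k) h t ts :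
  teq G (NPrim (PRec g h) (NS t :: ts)) (NPrim h (t :: NPrim (PRec g h) (t :: ts) :: ts)%vector).
Proof. apply Ax; constructor. Qed.

#[export] Instance NPrim1_proper G (p : prim 1) :
  Proper (teq G ==> teq G) (fun t => NPrim p [t]).
Proof. intros a b H; apply NPrim_cong; cbn; auto. Qed.
#[export] Instance NPrim2_proper G (p : prim 2) :
  Proper (teq G ==> teq G ==> teq G) (fun t u => NPrim p [t; u]).
Proof. intros a b H c d K; apply NPrim_cong; cbn; auto. Qed.
#[export] Instance NPrim3_proper G (p : prim 3) :
  Proper (teq G ==> teq G ==> teq G ==> teq G) (fun t u v => NPrim p [t; u; v]).
Proof. intros a b H c d K e f L; apply NPrim_cong; cbn; auto. Qed.

(** * Addition and multiplication *)

Definition tadd t u := NPrim padd [t; u].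
Definition tmul t u := NPrim pmul [t; u].
Definition tsub t u := NPrim psub [t; u].
Definition tpred t := NPrim ppred [t].
Definition tpow t u := NPrim ppow [t; u].
Definition one := NS NZero.

#[export] Instance tadd_proper G : Proper (teq G ==> teq G ==> teq G) tadd.
Proof. apply NPrim2_proper. Qed.
#[export] Instance tmul_proper G : Proper (teq G ==> teq G ==> teq G) tmul.
Proof. apply NPrim2_proper. Qed.
#[export] Instance tsub_proper G : Proper (teq G ==> teq G ==> teq G) tsub.
Proof. apply NPrim2_proper. Qed.
#[export] Instance tpow_proper G : Proper (teq G ==> teq G ==> teq G) tpow.
Proof. apply NPrim2_proper. Qed.
#[export] Instance tpred_proper G : Proper (teq G ==> teq G) tpred.
Proof. apply NPrim1_proper. Qed.

(** [induct t A r s] is induction on the variable [t] of the goal, which must be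
    the forcing of [A] at [t .: r] and [s] up to conversion. *)
Ltac induct t A r s :=
  match goal with
  | G : world |- context [?G'] =>
    constr_eq G G';
    pattern t, G;
    lazymatch goal with |- ?P t G =>
      refine (sem_ind A r s G (_ : P NZero G)
        (_ : forall (G' : world) t', incl G G' -> P t' G' -> P (NS t') G') t);
      cbv beta;
      [ | let G' := fresh "G'" in let I := fresh "I" in
          try clear t; intros G' t I; lift_hyps G G' I ]
    end
  end.

Ltac zero_case := etransitivity; [apply rec_zero|]; now apply by_unfolding.
Ltac succ_case := etransitivity; [apply rec_succ|]; now apply by_unfolding.

Lemma add_0_l G u : teq G (tadd NZero u) u.
Proof. zero_case. Qed.
Lemma add_S_l G t u : teq G (tadd (NS t) u) (NS (tadd t u)).
Proof. succ_case. Qed.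
Lemma mul_0_l G u : teq G (tmul NZero u) NZero.
Proof. zero_case. Qed.
Lemma mul_S_l G t u : teq G (tmul (NS t) u) (tadd (tmul t u) u).
Proof. succ_case. Qed.

Lemma add_0_r G t : teq G (tadd t NZero) t.
Proof.
induct t (EqN (tadd #0 NZero) #0) NVar FVar.
- apply add_0_l.
- intros IH. now rewrite add_S_l, IH.
Qed.

Lemma add_S_r G t u : teq G (tadd t (NS u)) (NS (tadd t u)).
Proof.
induct t (EqN (tadd #0 (NS #1)) (NS (tadd #0 #1))) (u .: NVar) FVar.
- now rewrite !add_0_l.
- intros IH. now rewrite !add_S_l, IH.
Qed.

Lemma add_comm G t u : teq G (tadd t u) (tadd u t).
Proof.
induct t (EqN (tadd #0 #1) (tadd #1 #0)) (u .: NVar) FVar.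
- now rewrite add_0_l, add_0_r.
- intros IH. now rewrite add_S_l, add_S_r, IH.
Qed.

Lemma add_assoc G t u v : teq G (tadd t (tadd u v)) (tadd (tadd t u) v).
Proof.
induct t (EqN (tadd #0 (tadd #1 #2)) (tadd (tadd #0 #1) #2)) (u .: v .: NVar) FVar.
- now rewrite !add_0_l.
- intros IH. now rewrite !add_S_l, IH.
Qed.

Lemma mul_0_r G t : teq G (tmul t NZero) NZero.
Proof.
induct t (EqN (tmul #0 NZero) NZero) NVar FVar.
- now rewrite mul_0_l.
- intros IH. now rewrite mul_S_l, add_0_r, IH.
Qed.

Lemma mul_S_r G t u : teq G (tmul t (NS u)) (tadd (tmul t u) t).
Proof.
induct t (EqN (tmul #0 (NS #1)) (tadd (tmul #0 #1) #0)) (u .: NVar) FVar.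
- now rewrite !mul_0_l, add_0_r.
- intros IH. rewrite !mul_S_l, !add_S_r, IH, <- !add_assoc.
  now rewrite (add_comm _ t u).
Qed.

Lemma mul_comm G t u : teq G (tmul t u) (tmul u t).
Proof.
induct t (EqN (tmul #0 #1) (tmul #1 #0)) (u .: NVar) FVar.
- now rewrite mul_0_l, mul_0_r.
- intros IH. now rewrite mul_S_l, mul_S_r, IH.
Qed.

Lemma mul_add_distr_r G t u v : teq G (tmul (tadd t u) v) (tadd (tmul t v) (tmul u v)).
Proof.
induct t (EqN (tmul (tadd #0 #1) #2) (tadd (tmul #0 #2) (tmul #1 #2))) (u .: v .: NVar) FVar.
- now rewrite add_0_l, mul_0_l, add_0_l.
- intros IH. rewrite add_S_l, !mul_S_l, IH, <- !add_assoc.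
  now rewrite (add_comm _ v).
Qed.

Lemma mul_assoc G t u v : teq G (tmul t (tmul u v)) (tmul (tmul t u) v).
Proof.
induct t (EqN (tmul #0 (tmul #1 #2)) (tmul (tmul #0 #1) #2)) (u .: v .: NVar) FVar.
- now rewrite !mul_0_l.
- intros IH. now rewrite !mul_S_l, IH, mul_add_distr_r.
Qed.

Lemma mul_1_l G t : teq G (tmul one t) t.
Proof. unfold one; now rewrite mul_S_l, mul_0_l, add_0_l. Qed.

Lemma NS_add G t : teq G (NS t) (tadd t one).
Proof. unfold one; now rewrite add_S_r, add_0_r. Qed.

(** Identities that hold in the empty context hold everywhere, so that the ring
    structure is only needed there. *)
Lemma semiring : semi_ring_theory NZero one tadd tmul (teq nil).
Proof.
split; intros; auto using add_0_l, add_comm, add_assoc, mul_1_l, mul_0_l, mul_comm,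
  mul_assoc, mul_add_distr_r.
Qed.

Lemma semiring_ext : sring_eq_ext tadd tmul (teq nil).
Proof. split; exact _. Qed.

Add Ring semiring : semiring (setoid (teq_equiv nil) semiring_ext).

Lemma teq_nil G t u : teq nil t u -> teq G t u.
Proof. intros H; apply prv_weak with nil; auto. intros x []. Qed.

Ltac nring := apply teq_nil; repeat rewrite NS_add; ring.

(** * Order *)

Ltac comp_zero_case := etransitivity; [apply red_sound|]; zero_case.
Ltac comp_succ_case := etransitivity; [apply red_sound|]; succ_case.

Lemma ex_falso G A : absurd G -> G ⊢ A.
Proof. apply BotE. Qed.

Lemma cov_absurd P G : absurd G -> cov P G.
Proof. intros H G' C I _; apply ex_falso. now apply prv_weak with G. Qed.

Lemma pred_0 G : teq G (tpred NZero) NZero.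
Proof. zero_case. Qed.
Lemma pred_S G t : teq G (tpred (NS t)) t.
Proof. succ_case. Qed.
Lemma NS_inj G t u : teq G (NS t) (NS u) -> teq G t u.
Proof. intros H; rewrite <- (pred_S G t), H; apply pred_S. Qed.
Lemma NS_neq_0 G t : teq G (NS t) NZero -> absurd G.
Proof.
intros H. apply (pimp_app _ _ _ (sem_axiom _ G ax_S_neq0 t)). exact H.
Qed.

(** Being nonzero as an equation: unlike a negation it is an atom. *)
Notation pos G t := (teq G t (NS (tpred t))).

Lemma pos_S G t : pos G (NS t).
Proof. now rewrite pred_S. Qed.

Lemma pos_absurd G t : pos G t -> teq G t NZero -> absurd G.
Proof. intros H E; rewrite H in E. now apply NS_neq_0 in E. Qed.

Lemma zero_or_pos G t : cov (fun G => teq G t NZero \/ pos G t) G.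
Proof.
induct t (Or (EqN #0 NZero) (EqN #0 (NS (tpred #0)))) NVar FVar.
- apply cov_ret; [exact _|]. left; reflexivity.
- intros _. apply cov_ret; [exact _|]. right; apply pos_S.
Qed.

Lemma pos_intro G t : pneg (fun G => teq G t NZero) G -> pos G t.
Proof.
intros H; open (zero_or_pos G t) as [E|E]; trivial.
apply ex_falso, (pimp_app _ _ _ H), E.
Qed.

Lemma sub_0_r G t : teq G (tsub t NZero) t.
Proof. comp_zero_case. Qed.
Lemma sub_S_r G t u : teq G (tsub t (NS u)) (tpred (tsub t u)).
Proof. comp_succ_case. Qed.
Lemma sub_SS G t u : teq G (tsub (NS t) (NS u)) (tsub t u).
Proof.
induct u (EqN (tsub (NS #1) (NS #0)) (tsub #1 #0)) (t .: NVar) FVar.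
- now rewrite sub_S_r, !sub_0_r, pred_S.
- intros IH; now rewrite sub_S_r, IH, sub_S_r.
Qed.
Lemma sub_0_l G u : teq G (tsub NZero u) NZero.
Proof.
induct u (EqN (tsub NZero #0) NZero) NVar FVar.
- now rewrite sub_0_r.
- intros IH; now rewrite sub_S_r, IH, pred_0.
Qed.
Lemma sub_add G t z : teq G (tsub t (tadd t z)) NZero.
Proof.
induct t (EqN (tsub #0 (tadd #0 #1)) NZero) (z .: NVar) FVar.
- apply sub_0_l.
- intros IH; now rewrite add_S_l, sub_SS.
Qed.

(** Order by truncated subtraction, in the shape to which the order of the
    language unfolds ([Lt_iff]). *)
Definition le (G : world) (t u : nterm) : Prop := teq G (tsub t u) NZero.
Notation lt G t u := (le G (NS t) u).
#[export] Instance le_proper G : Proper (teq G ==> teq G ==> iff) (le G).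
Proof. intros a b H c d K; unfold le; now rewrite H, K. Qed.
#[export] Instance mono_le t u : Mono (fun G => le G t u).
Proof. apply mono_teq. Qed.
#[export] Instance local_le t u : Local (fun G => le G t u).
Proof. apply local_teq. Qed.

Lemma le_intro G t u z : teq G u (tadd t z) -> le G t u.
Proof. unfold le; intros ->; apply sub_add. Qed.

Lemma le_add_sub G t : forall u,
  pimp (fun G => teq G (tsub t u) NZero) (fun G => teq G u (tadd t (tsub u t))) G.
Proof.
induct t (AllN (Imp (EqN (tsub #1 #0) NZero) (EqN #0 (tadd #1 (tsub #0 #1))))) NVar FVar.
- intros u; assume _. now rewrite sub_0_r, add_0_l.
- intros IH u; assume H. open (zero_or_pos G u) as [E|E].
  + rewrite E, sub_0_r in H. now apply ex_falso, NS_neq_0 with t.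
  + rewrite E, sub_SS in H. apply (pimp_app _ _ _ (IH _)) in H.
    rewrite E at 1 2. rewrite sub_SS, add_S_l. now rewrite H at 1.
Qed.

(** The witness is a term, the difference, so that this existence is one in the
    ambient logic. Inequalities thereby reduce to ring identities. *)
Lemma le_elim G t u : le G t u -> exists z, teq G u (tadd t z).
Proof. intros H; exists (tsub u t). apply (pimp_app _ _ _ (le_add_sub G t u)), H. Qed.

Lemma lt_or_le G t : forall u, cov (fun G => lt G t u \/ le G u t) G.
Proof.
unfold le.
induct t (AllN (Or (EqN (tsub (NS #1) #0) NZero) (EqN (tsub #0 #1) NZero))) NVar FVar.
- intros u; open (zero_or_pos G u) as [E|E]; (apply cov_ret; [exact _|]).
  + right; now rewrite E, sub_0_l.
  + left; now rewrite E, sub_SS, sub_0_l.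
- intros IH u; open (zero_or_pos G u) as [E|E].
  + apply cov_ret; [exact _|]. right; now rewrite E, sub_0_l.
  + open (IH (tpred u)) as [H|H]; (apply cov_ret; [exact _|]); rewrite E, !sub_SS; auto.
Qed.

Lemma add_cancel_l G t u v : teq G (tadd t u) (tadd t v) -> teq G u v.
Proof.
apply (pimp_app (fun G => teq G (tadd t u) (tadd t v)) (fun G => teq G u v)).
induct t (Imp (EqN (tadd #0 #1) (tadd #0 #2)) (EqN #1 #2)) (u .: v .: NVar) FVar.
- assume H; now rewrite !add_0_l in H.
- intros IH; assume H; apply (pimp_app _ _ _ IH). rewrite !add_S_l in H. now apply NS_inj.
Qed.

Lemma add_eq_self G t u : teq G (tadd t u) t -> teq G u NZero.
Proof. intros H; apply add_cancel_l with t; now rewrite H, add_0_r. Qed.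

Lemma add_eq_0_l G t u : teq G (tadd t u) NZero -> teq G t NZero.
Proof.
intros H; open (zero_or_pos G t) as [E|E]; trivial.
rewrite E, add_S_l in H; apply ex_falso; now apply NS_neq_0 in H.
Qed.

Lemma add_eq_0_r G t u : teq G (tadd t u) NZero -> teq G u NZero.
Proof. rewrite add_comm; apply add_eq_0_l. Qed.

Lemma le_refl G t : le G t t.
Proof. apply le_intro with NZero; nring. Qed.
Lemma le_0 G t : le G NZero t.
Proof. apply sub_0_l. Qed.
Lemma le_trans G t u v : le G t u -> le G u v -> le G t v.
Proof.
intros H K; apply le_elim in H as [y H]; apply le_elim in K as [z K].
apply le_intro with (tadd y z); rewrite K, H; nring.
Qed.
Lemma le_S G t : le G t (NS t).
Proof. apply le_intro with one; nring. Qed.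
Lemma le_antisym G t u : le G t u -> le G u t -> teq G t u.
Proof.
intros H K; apply le_elim in H as [y H]; apply le_elim in K as [z K].
rewrite H in K. assert (E : teq G (tadd t (tadd y z)) t) by (rewrite K at 2; nring).
apply add_eq_self, add_eq_0_l in E. now rewrite H, E, add_0_r.
Qed.
Lemma lt_irrefl G t : lt G t t -> absurd G.
Proof.
intros H; apply le_elim in H as [z H]; symmetry in H.
assert (E : teq G (tadd t (NS z)) t) by (rewrite <- H at 2; nring).
apply add_eq_self in E. now apply NS_neq_0 in E.
Qed.
Lemma lt_le_absurd G t u : lt G t u -> le G u t -> absurd G.
Proof. intros H K; apply (lt_irrefl G t); now apply le_trans with u. Qed.
Lemma lt_le G t u : lt G t u -> le G t u.
Proof. apply le_trans, le_S. Qed.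
Lemma le_SS G t u : le G (NS t) (NS u) <-> le G t u.
Proof. unfold le; now rewrite sub_SS. Qed.
Lemma le_0_inv G t : le G t NZero -> teq G t NZero.
Proof. intros H; apply le_antisym; auto using le_0. Qed.
Lemma pos_of_lt G t u : lt G t u -> pos G u.
Proof. intros H; apply le_elim in H as [z ->]; rewrite add_S_l; apply pos_S. Qed.
Lemma pos_lt G t : pos G t -> lt G NZero t.
Proof. intros ->; rewrite le_SS; apply le_0. Qed.

Lemma le_lt_or_eq G t u : le G t u -> cov (fun G => lt G t u \/ teq G t u) G.
Proof.
intros H; open (lt_or_le G t u) as [K|K]; (apply cov_ret; [exact _|]); auto using le_antisym.
Qed.

Lemma lt_S_cases G t u : lt G t (NS u) -> cov (fun G => lt G t u \/ teq G t u) G.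
Proof. rewrite le_SS; apply le_lt_or_eq. Qed.

Lemma trichotomy G t u : cov (fun G => lt G t u \/ teq G t u \/ lt G u t) G.
Proof.
open (lt_or_le G t u) as [H|H]; [apply cov_ret; [exact _|]; auto|].
open (le_lt_or_eq G u t H) as [K|K]; (apply cov_ret; [exact _|]); auto.
right; left; now symmetry.
Qed.

Lemma pneg_app G (P : wprop) : pneg P G -> P G -> absurd G.
Proof. apply pimp_app. Qed.

Lemma mul_eq_0 G t u : teq G (tmul t u) NZero -> pos G t -> teq G u NZero.
Proof.
intros H E; rewrite E, mul_S_l in H; now apply add_eq_0_r in H.
Qed.

Lemma mul_pos G t u : pos G t -> pos G u -> pos G (tmul t u).
Proof.
intros Ht Hu; apply pos_intro; assume H. apply pos_absurd with u; trivial.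
now apply mul_eq_0 with t.
Qed.

Lemma mul_cancel_l G t u v : pos G t -> teq G (tmul t u) (tmul t v) -> teq G u v.
Proof.
intros Ht H. assert (K : forall G u v, pos G t -> le G u v ->
  teq G (tmul t u) (tmul t v) -> teq G u v).
{ clear; intros G u v Ht L H; apply le_elim in L as [z L]. rewrite L in H.
  assert (E : teq G (tadd (tmul t u) (tmul t z)) (tmul t u)) by (rewrite H at 2; nring).
  apply add_eq_self, mul_eq_0 in E; trivial. now rewrite L, E, add_0_r. }
open (lt_or_le G u v) as [L|L].
- apply K; auto using lt_le.
- symmetry; apply K; auto. now symmetry.
Qed.

Lemma lt_unfold G t u : teq G (NPrim plt [t; u]) (tsub (NS t) u).
Proof. now apply by_unfolding. Qed.

Lemma Lt_iff G t u : teq G (NPrim plt [t; u]) NZero <-> lt G t u.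
Proof. unfold le; now rewrite lt_unfold. Qed.

Definition tif c a b := NPrim pif [c; a; b].
#[export] Instance tif_proper G : Proper (teq G ==> teq G ==> teq G ==> teq G) tif.
Proof. apply NPrim3_proper. Qed.

Lemma tif_zero G c a b : teq G c NZero -> teq G (tif c a b) a.
Proof. intros ->; zero_case. Qed.
Lemma tif_pos G c a b : pos G c -> teq G (tif c a b) b.
Proof. intros ->; succ_case. Qed.

Definition teqb a b := NPrim peq [a; b].
#[export] Instance teqb_proper G : Proper (teq G ==> teq G ==> teq G) teqb.
Proof. apply NPrim2_proper. Qed.

Lemma eqb_unfold G a b : teq G (teqb a b) (tadd (tsub a b) (tsub b a)).
Proof. now apply by_unfolding. Qed.

Lemma eqb_iff G a b : teq G (teqb a b) NZero <-> teq G a b.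
Proof.
rewrite eqb_unfold; split; intros H.
- apply le_antisym; [now apply add_eq_0_l in H | now apply add_eq_0_r in H].
- rewrite H, (le_refl G b : teq _ _ _). apply add_0_l.
Qed.

Lemma eqb_cases G a b :
  cov (fun G => teq G a b /\ teq G (teqb a b) NZero
      \/ pneg (fun G => teq G a b) G /\ pos G (teqb a b)) G.
Proof.
open (zero_or_pos G (teqb a b)) as [H|H]; (apply cov_ret; [exact _|]).
- left; split; trivial; now apply eqb_iff.
- right; split; trivial; assume E. apply eqb_iff in E. now apply pos_absurd in H.
Qed.

Ltac ret := apply cov_ret; [exact _|].

(** * Divisibility and powers *)

Definition dvd (G : world) (d n : nterm) : Prop :=
  cov (fun G => exists k, teq G n (tmul d k)) G.
#[export] Instance mono_dvd d n : Mono (fun G => dvd G d n).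
Proof. apply mono_cov. Qed.
#[export] Instance local_dvd d n : Local (fun G => dvd G d n).
Proof. apply local_cov. Qed.

Lemma dvd_intro G d n k : teq G n (tmul d k) -> dvd G d n.
Proof. intros H; unfold dvd; ret; now exists k. Qed.

Tactic Notation "open_dvd" hyp(H) "as" simple_intropattern(p) := unfold dvd in H; open H as p.

Lemma dvd_proper_imp G d d' n n' : teq G d d' -> teq G n n' -> dvd G d n -> dvd G d' n'.
Proof.
intros Hd Hn H; open_dvd H as [k H]. apply dvd_intro with k; now rewrite <- Hd, <- Hn.
Qed.
#[export] Instance dvd_proper G : Proper (teq G ==> teq G ==> iff) (dvd G).
Proof.
intros d d' Hd n n' Hn; split; apply dvd_proper_imp; trivial; now symmetry.
Qed.

Lemma dvd_refl G n : dvd G n n.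
Proof. apply dvd_intro with one; nring. Qed.
Lemma dvd_trans G a b c : dvd G a b -> dvd G b c -> dvd G a c.
Proof.
intros H K; open_dvd H as [x H]; open_dvd K as [y K].
apply dvd_intro with (tmul x y); rewrite K, H; nring.
Qed.
Lemma dvd_mul_r G a b c : dvd G a b -> dvd G a (tmul b c).
Proof. intros H; apply dvd_trans with b; trivial; now apply dvd_intro with c. Qed.
Lemma dvd_mul_l G a b c : dvd G a b -> dvd G a (tmul c b).
Proof. rewrite mul_comm; apply dvd_mul_r. Qed.
Lemma dvd_0 G a : dvd G a NZero.
Proof. apply dvd_intro with NZero; nring. Qed.
Lemma dvd_add_cancel G d a b : dvd G d a -> dvd G d (tadd a b) -> dvd G d b.
Proof.
intros H K; open_dvd H as [k H]; open_dvd K as [m K]. rewrite H in K.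
open (lt_or_le G m k) as [L|L]; apply le_elim in L as [z L]; rewrite L in K.
- assert (E : teq G b NZero); [|rewrite E; apply dvd_0].
  apply add_eq_0_r with (tmul d (NS z)), add_eq_self with (tmul d m).
  rewrite <- K at 2; nring.
- apply dvd_intro with z, add_cancel_l with (tmul d k). rewrite K; nring.
Qed.
Lemma dvd_le G d n : pos G n -> dvd G d n -> le G d n.
Proof.
intros P H; open_dvd H as [k H]. open (zero_or_pos G k) as [K|K].
- apply ex_falso, pos_absurd with n; trivial. now rewrite H, K, mul_0_r.
- rewrite K in H. apply le_intro with (tmul d (tpred k)). rewrite H; nring.
Qed.

Definition trem n d := NPrim prem [n; d].
#[export] Instance trem_proper G : Proper (teq G ==> teq G ==> teq G) trem.
Proof. apply NPrim2_proper. Qed.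

Lemma rem_0 G d : teq G (trem NZero d) NZero.
Proof. zero_case. Qed.
Lemma rem_S G n d :
  teq G (trem (NS n) d) (tif (teqb (NS (trem n d)) d) NZero (NS (trem n d))).
Proof. succ_case. Qed.

Lemma rem_spec G d n : pos G d ->
  cov (fun G => exists k, teq G n (tadd (tmul d k) (trem n d))) G /\ lt G (trem n d) d.
Proof.
intros P; unfold le.
induct n (And (ExN (EqN #1 (tadd (tmul #2 #0) (trem #1 #2)))) (EqN (tsub (NS (trem #0 #1)) #1) NZero))
  (d .: NVar) FVar.
- split.
  + ret; exists NZero. rewrite rem_0; nring.
  + rewrite rem_0. now apply pos_lt.
- intros [H L]. open (eqb_cases G (NS (trem n d)) d) as [[E K]|[E K]].
  + split.
    * open H as [k H]. ret; exists (NS k).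
      rewrite rem_S, tif_zero, add_0_r by trivial.
      transitivity (tadd (tmul d k) (NS (trem n d))).
      { rewrite H at 1; nring. } { rewrite E; nring. }
    * rewrite rem_S, tif_zero by trivial. now apply pos_lt.
  + split.
    * open H as [k H]. ret; exists k.
      rewrite rem_S, tif_pos, add_S_r by trivial. now rewrite <- H.
    * rewrite rem_S, tif_pos by trivial.
      open (le_lt_or_eq _ _ _ L) as [M|M]; trivial.
      apply ex_falso. exact (pneg_app _ _ E M).
Qed.

(** Divisibility is decidable through the remainder. *)
Lemma rem_zero_iff G d n : pos G d -> teq G (trem n d) NZero <-> dvd G d n.
Proof.
intros P; destruct (rem_spec G d n P) as [H L]; split; intros K.
- open H as [k H]. apply dvd_intro with k. rewrite K, add_0_r in H; trivial.
- open H as [k H].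
  assert (D : dvd G d (trem n d)).
  { rewrite H in K at 1. revert K; apply dvd_add_cancel. now apply dvd_intro with k. }
  open (zero_or_pos G (trem n d)) as [Z|Z]; trivial.
  apply ex_falso, lt_le_absurd with (trem n d) d; trivial. now apply dvd_le.
Qed.

Lemma rem_pos G d n : pos G d -> pneg (fun G => dvd G d n) G -> pos G (trem n d).
Proof.
intros P H; apply pos_intro; assume E. apply rem_zero_iff in E; trivial. exact (pneg_app _ _ H E).
Qed.

Lemma pow_0 G x : teq G (tpow x NZero) one.
Proof. comp_zero_case. Qed.
Lemma pow_S G x y : teq G (tpow x (NS y)) (tmul (tpow x y) x).
Proof. comp_succ_case. Qed.
Lemma pow_add G x y z : teq G (tpow x (tadd y z)) (tmul (tpow x y) (tpow x z)).
Proof.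
induct y (EqN (tpow #1 (tadd #0 #2)) (tmul (tpow #1 #0) (tpow #1 #2))) (x .: z .: NVar) FVar.
- rewrite pow_0, add_0_l; nring.
- intros IH; rewrite add_S_l, !pow_S, IH; nring.
Qed.
Lemma pow_pos G x y : pos G x -> pos G (tpow x y).
Proof.
intros P; induct y (EqN (tpow #1 #0) (NS (tpred (tpow #1 #0)))) (x .: NVar) FVar.
- rewrite pow_0; apply pos_S.
- intros IH; rewrite pow_S; now apply mul_pos.
Qed.

Lemma pos_of_2 G q : le G Two q -> pos G q.
Proof. intros H; apply pos_of_lt with one, H. Qed.

Lemma lt_pow G x y : le G Two x -> lt G y (tpow x y).
Proof.
intros P; unfold le.
induct y (EqN (tsub (NS #0) (tpow #1 #0)) NZero) (x .: NVar) FVar.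
- rewrite pow_0; apply le_refl.
- intros IH; rewrite pow_S. apply le_elim in IH as [z IH], P as [w P].
  rewrite IH, P at 1. unfold Two.
  apply le_intro with (tadd (tadd (tadd y z) z) (tmul (NS (tadd y z)) w)). nring.
Qed.

Lemma NPrim2_teq G p a b c d : teq G a b -> teq G c d -> teq G (NPrim p [a; c]) (NPrim p [b; d]).
Proof. intros H K; exact (NPrim2_proper G p a b H c d K). Qed.

(** * Bounded search and prime numbers *)

Definition tleast f n y := NPrim (pleast f) [n; y].
#[export] Instance tleast_proper f G : Proper (teq G ==> teq G ==> teq G) (tleast f).
Proof. apply NPrim2_proper. Qed.

Lemma least_0 G f y : teq G (tleast f NZero y) NZero.
Proof. zero_case. Qed.
Lemma least_S G f n y :
  teq G (tleast f (NS n) y) (tif (NPrim f [tleast f n y; y]) (tleast f n y) (NS n)).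
Proof. succ_case. Qed.

Lemma least_spec G f y n :
  le G (tleast f n y) n /\
  cov (fun G => teq G (tleast f n y) n \/ teq G (NPrim f [tleast f n y; y]) NZero) G /\
  (forall x, pimp (fun G => lt G x (tleast f n y)) (fun G => pos G (NPrim f [x; y])) G).
Proof.
unfold le.
induct n (And (EqN (tsub (tleast f #0 #1) #0) NZero)
         (And (Or (EqN (tleast f #0 #1) #0) (EqN (NPrim f [tleast f #0 #1; #1]) NZero))
           (AllN (Imp (EqN (tsub (NS #0) (tleast f #1 #2)) NZero)
              (EqN (NPrim f [#0; #2]) (NS (tpred (NPrim f [#0; #2]))))))))
   (y .: NVar) FVar.
- assert (R : forall H, teq H (tleast f NZero y) NZero) by (intros; apply least_0).
  split; [|split].
  + rewrite R; apply le_refl.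
  + ret; left; apply R.
  + intros x; assume H. rewrite R in H. now apply ex_falso, lt_le_absurd with x NZero, le_0.
- intros [Ha [Hb Hc]]. open (zero_or_pos G (NPrim f [tleast f n y; y])) as [E|E].
  + assert (R : teq G (tleast f (NS n) y) (tleast f n y)) by now rewrite least_S, tif_zero.
    split; [|split].
    * rewrite R. apply le_trans with n; auto using le_S.
    * ret; right. now rewrite (NPrim2_teq G f _ _ _ _ R (reflexivity y)).
    * intros x; assume H. rewrite R in H. now apply (pimp_app _ _ _ (Hc x)).
  + assert (R : teq G (tleast f (NS n) y) (NS n)) by now rewrite least_S, tif_pos.
    split; [|split].
    * rewrite R. apply le_refl.
    * ret; now left.
    * intros x; assume H. rewrite R in H.
      open Hb as [M|M]; [|now apply ex_falso, pos_absurd with (1 := E)].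
      open (lt_S_cases _ _ _ H) as [K|K].
      -- rewrite <- M in K. now apply (pimp_app _ _ _ (Hc x)).
      -- assert (Q : teq G (tleast f n y) x) by (rewrite M; now symmetry).
         rewrite (NPrim2_teq G f _ _ _ _ Q (reflexivity y)) in E. exact E.
Qed.

(** Primality as the atom that the language has for it. *)
Definition prime (G : world) q := teq G (NPrim pprime [q]) NZero.
#[export] Instance prime_proper G : Proper (teq G ==> iff) (prime G).
Proof. intros a b H; unfold prime. now rewrite (NPrim1_proper G pprime a b H). Qed.
#[export] Instance mono_prime q : Mono (fun G => prime G q).
Proof. apply mono_teq. Qed.
#[export] Instance local_prime q : Local (fun G => prime G q).
Proof. apply local_teq. Qed.

(** The test that the definition of [pprime] searches with: x + 2 divides y. *)
Definition ptest : prim 2 := PComp prem [x1; pS (pS x0)].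

Lemma test_unfold G x y : teq G (NPrim ptest [x; y]) (trem y (NS (NS x))).
Proof. now apply by_unfolding. Qed.

Lemma prime_unfold G q :
  teq G (NPrim pprime [q])
    (tadd (tsub Two q) (teqb (tleast ptest (tsub q Two) q) (tsub q Two))).
Proof. now apply by_unfolding. Qed.

Lemma prime_ge_2 G q : prime G q -> le G Two q.
Proof. unfold prime; rewrite prime_unfold; apply add_eq_0_l. Qed.

Lemma sub_add_cancel G t z : teq G (tsub (tadd t z) t) z.
Proof.
induct t (EqN (tsub (tadd #0 #1) #0) #1) (z .: NVar) FVar.
- now rewrite sub_0_r, add_0_l.
- intros IH; now rewrite add_S_l, sub_SS.
Qed.

(** A divisor [d] other than [q], neither 0 nor 1, would be found by the search,
    at the place [d - 2]. *)
Lemma prime_divisor G q d : prime G q -> dvd G d q ->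
  cov (fun G => teq G d one \/ teq G d q) G.
Proof.
intros H D. assert (P := prime_ge_2 G q H). assert (Pq := pos_of_2 G q P).
assert (L : le G d q) by now apply dvd_le.
assert (E : teq G (tleast ptest (tsub q Two) q) (tsub q Two)).
{ unfold prime in H; rewrite prime_unfold in H. now apply eqb_iff, add_eq_0_r with (1 := H). }
destruct (least_spec G ptest q (tsub q Two)) as (_ & _ & K).
apply le_elim in P as [z P].
assert (R : teq G (tsub q Two) z). { now rewrite P, sub_add_cancel. }
open (zero_or_pos G d) as [Z|Z].
{ rewrite Z in D; open_dvd D as [k D].
  apply cov_absurd, pos_absurd with q; trivial. now rewrite D, mul_0_l. }
open (zero_or_pos G (tpred d)) as [Y|Y]; [ret; left; now rewrite Z, Y|].
rewrite Y in Z. set (x := tpred (tpred d)) in *.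
open (le_lt_or_eq _ _ _ L) as [M|M]; [|ret; now right].
apply cov_absurd.
assert (X : lt G x (tleast ptest (tsub q Two) q)).
{ rewrite E, R. rewrite Z, P in M. apply le_elim in M as [w M].
  apply le_intro with w. apply add_cancel_l with Two. rewrite M; unfold Two; nring. }
assert (N := pimp_app _ _ _ (K x) X). cbv beta in N. rewrite test_unfold, <- Z in N.
apply pos_absurd with (1 := N). apply rem_zero_iff; trivial. rewrite Z; apply pos_S.
Qed.

Lemma prime_intro G q : le G Two q ->
  (forall x, pimp (fun G => lt G (NS (NS x)) q) (pneg (fun G => dvd G (NS (NS x)) q)) G) ->
  prime G q.
Proof.
intros P H; unfold prime; rewrite prime_unfold.
assert (Z : teq G (tsub Two q) NZero) by exact P. rewrite Z, add_0_l. apply eqb_iff.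
destruct (least_spec G ptest q (tsub q Two)) as (L & K & _).
open (le_lt_or_eq _ _ _ L) as [M|M]; trivial.
open K as [E|E]; trivial. rewrite test_unfold in E. apply rem_zero_iff in E; [|apply pos_S].
set (x := tleast ptest (tsub q Two) q) in *.
assert (X : lt G (NS (NS x)) q).
{ apply le_elim in P as [z P]. rewrite P, sub_add_cancel in M. apply le_elim in M as [w M].
  rewrite P, M. apply le_intro with w. unfold Two; nring. }
apply ex_falso, (pneg_app G (fun G => dvd G (NS (NS x)) q)); trivial.
exact (pimp_app _ _ _ (H x) X).
Qed.

Lemma prime_two G : prime G Two.
Proof.
apply prime_intro; [apply le_refl|]. intros x; assume H. unfold Two in H.
rewrite !le_SS in H. assume _. apply lt_le_absurd with x NZero; auto using le_0.
Qed.

(** The least divisor above 1 is prime, because its divisors divide [n] too. *)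
Lemma prime_divisor_exists G n : le G Two n ->
  exists d, prime G d /\ dvd G d n.
Proof.
intros P. destruct (least_spec G ptest n (tsub n Two)) as (L & K & N).
set (x := tleast ptest (tsub n Two) n) in *. exists (NS (NS x)).
assert (D : dvd G (NS (NS x)) n).
{ open K as [E|E].
  - rewrite E. apply le_elim in P as [z P]. rewrite P, sub_add_cancel.
    apply dvd_intro with one. unfold Two; nring.
  - rewrite test_unfold in E. apply rem_zero_iff in E; trivial. apply pos_S. }
split; trivial. apply prime_intro.
- apply le_intro with x. unfold Two; nring.
- intros y; assume H; assume E. rewrite !le_SS in H.
  assert (M := pimp_app _ _ _ (N y) H); cbv beta in M. rewrite test_unfold in M.
  apply pos_absurd with (1 := M), rem_zero_iff; [apply pos_S|]. now apply dvd_trans with (1 := E).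
Qed.

Definition tfact n := NPrim pfact [n].
Lemma fact_0 G : teq G (tfact NZero) one.
Proof. zero_case. Qed.
Lemma fact_S G n : teq G (tfact (NS n)) (tmul (NS n) (tfact n)).
Proof. succ_case. Qed.

Lemma fact_pos G n : pos G (tfact n).
Proof.
induct n (EqN (tfact #0) (NS (tpred (tfact #0)))) NVar FVar.
- rewrite fact_0; apply pos_S.
- intros IH; rewrite fact_S; apply mul_pos; trivial; apply pos_S.
Qed.

Lemma dvd_fact G d n : pos G d -> le G d n -> dvd G d (tfact n).
Proof.
intros P; apply (pimp_app (fun G => le G d n) (fun G => dvd G d (tfact n))).
induct n (Imp (EqN (tsub #1 #0) NZero) (ExN (EqN (tfact #1) (tmul #2 #0)))) (d .: NVar) FVar.
- assume L. apply cov_absurd, pos_absurd with (1 := P). now apply le_0_inv.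
- intros IH; assume L. fold (dvd G d (tfact (NS n))). rewrite fact_S.
  open (le_lt_or_eq _ _ _ L) as [K|K].
  + rewrite le_SS in K. apply dvd_mul_l. exact (pimp_app _ _ _ IH K).
  + rewrite K; apply dvd_mul_r, dvd_refl.
Qed.

Definition tnext m := NPrim pnextprime [m].
#[export] Instance tnext_proper G : Proper (teq G ==> teq G) tnext.
Proof. apply NPrim1_proper. Qed.

Definition pnexttest : prim 2 := PComp padd [PComp plt [x1; x0]; PComp pprime [x0]].

Lemma nexttest_unfold G x m :
  teq G (NPrim pnexttest [x; m]) (tadd (tsub (NS m) x) (NPrim pprime [x])).
Proof. now apply by_unfolding. Qed.

Lemma next_unfold G m : teq G (tnext m) (tleast pnexttest (NS (NS (tfact m))) m).
Proof. now apply by_unfolding. Qed.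

(** Euclid: a prime divisor of [m! + 1] is larger than [m], as otherwise it
    would divide [m!] and hence 1; so the search below [m! + 2] succeeds. *)
Lemma next_spec G m : prime G (tnext m) /\ lt G m (tnext m).
Proof.
destruct (prime_divisor_exists G (NS (tfact m))) as [d [Pd Dd]].
{ rewrite fact_pos; unfold Two; rewrite !le_SS; apply le_0. }
assert (Ld : le G d (NS (tfact m))) by (apply dvd_le; trivial; apply pos_S).
assert (Ud : lt G m d).
{ open (lt_or_le G m d) as [L|L]; trivial. assert (P2 := prime_ge_2 _ _ Pd).
  apply dvd_fact in L; [|now apply pos_of_2].
  rewrite NS_add in Dd. apply (dvd_add_cancel _ _ _ _ L), dvd_le in Dd; [|apply pos_S].
  apply ex_falso, (lt_irrefl G one), le_trans with d; trivial. }
rewrite next_unfold.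
destruct (least_spec G pnexttest m (NS (NS (tfact m)))) as (_ & K & N).
set (x := tleast _ _ _) in *.
assert (E : teq G (NPrim pnexttest [x; m]) NZero).
{ open K as [E|E]; trivial. apply ex_falso.
  assert (X : lt G d x) by (rewrite E, le_SS; trivial).
  assert (M := pimp_app _ _ _ (N d) X); cbv beta in M.
  apply pos_absurd with (1 := M). rewrite nexttest_unfold.
  unfold prime in Pd; rewrite Pd. rewrite (Ud : teq _ _ _). apply add_0_l. }
rewrite nexttest_unfold in E. split.
- now apply add_eq_0_r in E.
- now apply add_eq_0_l in E.
Qed.

Definition tp k := NPrim pnth_prime [k].
#[export] Instance tp_proper G : Proper (teq G ==> teq G) tp.
Proof. apply NPrim1_proper. Qed.
Lemma p_0 G : teq G (tp NZero) Two.
Proof. zero_case. Qed.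
Lemma p_S G k : teq G (tp (NS k)) (tnext (tp k)).
Proof. succ_case. Qed.

Lemma p_prime G k : prime G (tp k).
Proof.
unfold prime.
induct k (EqN (NPrim pprime [tp #0]) NZero) NVar FVar.
- fold (prime G (tp NZero)); rewrite p_0; apply prime_two.
- intros _. fold (prime G (tp (NS k))). rewrite p_S; apply next_spec.
Qed.

Lemma p_pos G k : pos G (tp k).
Proof. apply pos_of_2, prime_ge_2, p_prime. Qed.

Lemma p_lt_S G k : lt G (tp k) (tp (NS k)).
Proof. rewrite (p_S G k); apply next_spec. Qed.

Lemma p_mono G j k : lt G j k -> lt G (tp j) (tp k).
Proof.
intros L; apply le_elim in L as [z L]; rewrite L; clear L k. unfold le.
induct z (EqN (tsub (NS (tp #1)) (tp (tadd (NS #1) #0))) NZero) (j .: NVar) FVar.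
- rewrite add_0_r; apply p_lt_S.
- intros IH. rewrite (add_S_r G (NS j) z). apply le_trans with (tp (tadd (NS j) z)); trivial.
  apply lt_le, p_lt_S.
Qed.

Lemma lt_p G k : lt G k (tp k).
Proof.
unfold le.
induct k (EqN (tsub (NS #0) (tp #0)) NZero) NVar FVar.
- apply pos_lt, p_pos.
- intros IH. apply le_trans with (NS (tp k)); [now rewrite le_SS | apply p_lt_S].
Qed.

(** * Euclid's lemma and valuations *)

Lemma pimp_app4 {P1 P2 P3 P4 Q : wprop} {G} :
  pimp P1 (pimp P2 (pimp P3 (pimp P4 Q))) G -> P1 G -> P2 G -> P3 G -> P4 G -> Q G.
Proof. intros H p1 p2 p3 p4; 
  exact (H G (incl_refl G) p1 G (incl_refl G) p2 G (incl_refl G) p3 G (incl_refl G) p4). Qed.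

(** Strong induction on [a], with [n] as its bound: the remainder of [q] by [a]
    is smaller than [a], nonzero unless [a] is 1, and its product with [b] is
    again a multiple of [q]. *)
Lemma euclid_small G q b n : prime G q -> forall a,
  pimp (fun G => lt G a n) (pimp (fun G => pos G a) (pimp (fun G => lt G a q)
    (pimp (fun G => dvd G q (tmul a b)) (fun G => dvd G q b)))) G.
Proof.
intros Pq; unfold dvd, le.
induct n (AllN (Imp (EqN (tsub (NS #0) #1) NZero) (Imp (EqN #0 (NS (tpred #0)))
   (Imp (EqN (tsub (NS #0) #2) NZero)
     (Imp (ExN (EqN (tmul #1 #4) (tmul #3 #0))) (ExN (EqN #4 (tmul #3 #0))))))))
  (q .: b .: NVar) FVar.
- intros a; assume L; assume _; assume _; assume _.
  apply cov_absurd, (lt_le_absurd G a NZero); [exact L | apply le_0].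
- intros IH a; assume L; assume Pa; assume La; assume D.
  fold (dvd G q (tmul a b)) in D. fold (dvd G q b).
  open (lt_S_cases G a n L) as [M|M]; [exact (pimp_app4 (IH a) M Pa La D)|].
  destruct (rem_spec G a q Pa) as [E R].
  open (zero_or_pos G (trem q a)) as [Z|Z].
  + apply rem_zero_iff in Z; trivial. open (prime_divisor G q a Pq Z) as [Q|Q].
    * now rewrite Q, mul_1_l in D.
    * rewrite Q in La. apply cov_absurd, (lt_irrefl G q), La.
  + refine (pimp_app4 (IH (trem q a)) _ _ _ _); trivial.
    * now rewrite <- M.
    * apply le_trans with a; trivial. now apply lt_le.
    * open E as [k E]. apply dvd_add_cancel with (tmul k (tmul a b)); [now apply dvd_mul_l|].
      apply dvd_intro with b. rewrite E at 2. nring.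
Qed.

(** The remainder of [a] by [q] reduces this to a factor below [q]. *)
Lemma euclid G q a b : prime G q -> dvd G q (tmul a b) ->
  cov (fun G => dvd G q a \/ dvd G q b) G.
Proof.
intros Pq D. assert (P := pos_of_2 _ _ (prime_ge_2 _ _ Pq)).
destruct (rem_spec G q a P) as [E R].
open (zero_or_pos G (trem a q)) as [Z|Z]; ret.
- left; now apply rem_zero_iff.
- right. open E as [k E].
  refine (pimp_app4 (euclid_small G q b q Pq (trem a q)) _ _ _ _); trivial.
  apply dvd_add_cancel with (tmul (tmul q k) b).
  + apply dvd_intro with (tmul k b); nring.
  + assert (F : teq G (tadd (tmul (tmul q k) b) (tmul (trem a q) b)) (tmul a b)).
    { rewrite E at 2; nring. }
    now rewrite F.
Qed.

Lemma prime_ndvd_one G q : prime G q -> dvd G q one -> absurd G.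
Proof.
intros P D. apply dvd_le in D; [|apply pos_S]. apply lt_le_absurd with one q; trivial.
now apply prime_ge_2.
Qed.

Notation ndvd d n := (pneg (fun G => dvd G d n)).

Lemma ndvd_mul G q a b : prime G q -> ndvd q a G -> ndvd q b G -> ndvd q (tmul a b) G.
Proof.
intros P Ha Hb; assume D. open (euclid G q a b P D) as [H|H].
- exact (pneg_app _ _ Ha H).
- exact (pneg_app _ _ Hb H).
Qed.

Lemma ndvd_proper_imp G q a b : teq G a b -> ndvd q a G -> ndvd q b G.
Proof. intros E H; assume D. rewrite <- E in D. exact (pneg_app _ _ H D). Qed.

Lemma ndvd_pow G q a e : prime G q -> ndvd q a G -> ndvd q (tpow a e) G.
Proof.
intros P H; unfold dvd.
induct e (Neg (ExN (EqN (tpow #2 #1) (tmul #3 #0)))) (a .: q .: NVar) FVar.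
- assume D. fold (dvd G q (tpow a NZero)) in D. rewrite pow_0 in D. now apply (prime_ndvd_one G q).
- intros IH. assert (K : ndvd q (tmul (tpow a e) a) G) by now apply ndvd_mul.
  revert K; apply ndvd_proper_imp. now rewrite pow_S.
Qed.

Lemma p_ndvd_p G j l : pneg (fun G => teq G j l) G -> ndvd (tp j) (tp l) G.
Proof.
intros H; assume D. open (prime_divisor G _ _ (p_prime G l) D) as [E|E].
- apply (prime_ndvd_one G (tp j)); [apply p_prime|]. rewrite E; apply dvd_refl.
- open (trichotomy G j l) as [K|[K|K]].
  + apply p_mono in K. rewrite E in K. now apply lt_irrefl in K.
  + exact (pneg_app _ _ H K).
  + apply p_mono in K. rewrite E in K. now apply lt_irrefl in K.
Qed.

Definition tentry s i := NPrim pentry [s; i].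
Definition tlen s := NPrim plength [s].
#[export] Instance tentry_proper G : Proper (teq G ==> teq G ==> teq G) tentry.
Proof. apply NPrim2_proper. Qed.
#[export] Instance tlen_proper G : Proper (teq G ==> teq G) tlen.
Proof. apply NPrim1_proper. Qed.

(** The product of the p(j)^s(j) for [j < k]. *)
Definition pprod : prim 2 :=
  PRec (pconst 1) (PComp pmul [x1; PComp ppow [PComp pnth_prime [x0]; PComp pentry [x2; x0]]]).
Definition tprod k s := NPrim pprod [k; s].
#[export] Instance tprod_proper G : Proper (teq G ==> teq G ==> teq G) tprod.
Proof. apply NPrim2_proper. Qed.

Lemma prod_0 G s : teq G (tprod NZero s) one.
Proof. zero_case. Qed.
Lemma prod_S G k s : teq G (tprod (NS k) s) (tmul (tprod k s) (tpow (tp k) (tentry s k))).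
Proof. succ_case. Qed.

Lemma lt_neq G j k : lt G j k -> pneg (fun G => teq G j k) G.
Proof. intros L; assume E. rewrite E in L; now apply lt_irrefl in L. Qed.
Lemma lt_neq_sym G j k : lt G j k -> pneg (fun G => teq G k j) G.
Proof. intros L; assume E. rewrite E in L; now apply lt_irrefl in L. Qed.

Lemma prod_ndvd G s j k : pimp (fun G => le G k j) (ndvd (tp j) (tprod k s)) G.
Proof.
unfold le, dvd.
induct k (Imp (EqN (tsub #0 #1) NZero) (Neg (ExN (EqN (tprod #1 #3) (tmul (tp #2) #0)))))
  (j .: s .: NVar) FVar.
- assume _. assume D. fold (dvd G (tp j) (tprod NZero s)) in D. rewrite prod_0 in D.
  apply prime_ndvd_one with (tp j); trivial. apply p_prime.
- intros IH; assume L.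
  apply (ndvd_proper_imp G (tp j) (tmul (tprod k s) (tpow (tp k) (tentry s k)))); [now rewrite prod_S|].
  apply ndvd_mul; [apply p_prime | |].
  + apply (pimp_app _ _ _ IH). now apply lt_le.
  + apply ndvd_pow; [apply p_prime|]. now apply p_ndvd_p, lt_neq_sym.
Qed.

(** The exponent of the [j]-th prime in [N] is [e]. *)
Definition has_val (j e N : nterm) : wprop := cov (fun G =>
  exists R, teq G N (tmul (tpow (tp j) e) R) /\ ndvd (tp j) R G).

Lemma has_val_mul_pow G j e N k f : pneg (fun G => teq G j k) G ->
  has_val j e N G -> has_val j e (tmul N (tpow (tp k) f)) G.
Proof.
intros J H; unfold has_val in *; open H as [R [E D]]; ret.
exists (tmul R (tpow (tp k) f)); split; [rewrite E; nring|].
apply ndvd_mul; trivial; [apply p_prime|]. apply ndvd_pow; [apply p_prime|]. now apply p_ndvd_p.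
Qed.

Lemma has_val_proper_imp G j e N N' : teq G N N' -> has_val j e N G -> has_val j e N' G.
Proof.
intros J H; unfold has_val in *; open H as [R [E D]]; ret.
exists R; split; trivial. now rewrite <- J.
Qed.

Lemma prod_has_val G s j k : pimp (fun G => lt G j k) (has_val j (tentry s j) (tprod k s)) G.
Proof.
unfold le, has_val, dvd.
induct k (Imp (EqN (tsub (NS #1) #0) NZero)
    (ExN (And (EqN (tprod #1 #3) (tmul (tpow (tp #2) (tentry #3 #2)) #0))
      (Neg (ExN (EqN #1 (tmul (tp #3) #0)))))))
  (j .: s .: NVar) FVar.
- assume L. apply cov_absurd, (lt_le_absurd G j NZero); [exact L | apply le_0].
- intros IH; assume L. fold (has_val j (tentry s j) (tprod (NS k) s) G).
  apply (has_val_proper_imp G j _ (tmul (tprod k s) (tpow (tp k) (tentry s k)))); [now rewrite prod_S|].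
  open (lt_S_cases G j k L) as [M|M].
  + apply has_val_mul_pow; [now apply lt_neq|]. apply (pimp_app _ _ _ IH), M.
  + unfold has_val; ret. exists (tprod k s); split; [rewrite M; nring|].
    apply (pimp_app _ _ _ (prod_ndvd G s j k)). rewrite M; apply le_refl.
Qed.

Definition tval n q N := NPrim pval [n; q; N].
#[export] Instance tval_proper G : Proper (teq G ==> teq G ==> teq G ==> teq G) tval.
Proof. apply NPrim3_proper. Qed.
Lemma val_0 G q N : teq G (tval NZero q N) NZero.
Proof. zero_case. Qed.
Lemma val_S G n q N : teq G (tval (NS n) q N)
  (tif (trem N (tpow q (NS n))) (NS n) (tval n q N)).
Proof. succ_case. Qed.

(** [val_S] keeps the last exponent that succeeds, which is [e] once the search
    has passed [e]. *)
Lemma val_spec G n q N e : pos G q -> dvd G (tpow q e) N ->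
  (forall f, pimp (fun G => lt G e f) (ndvd (tpow q f) N) G) ->
  le G e n -> teq G (tval n q N) e.
Proof.
intros Q D H. apply (pimp_app (fun G => le G e n) (fun G => teq G (tval n q N) e)). unfold le.
induct n (Imp (EqN (tsub #1 #0) NZero) (EqN (tval #0 #2 #3) #1)) (e .: q .: N .: NVar) FVar.
- assume L. apply le_0_inv in L. now rewrite val_0, L.
- intros IH; assume L. rewrite val_S.
  open (zero_or_pos G (trem N (tpow q (NS n)))) as [Z|Z].
  + rewrite tif_zero by trivial. apply le_antisym; trivial.
    open (lt_or_le G e (NS n)) as [M|M]; trivial.
    apply ex_falso, (pneg_app _ _ (pimp_app _ _ _ (H _) M)).
    apply rem_zero_iff; trivial. now apply pow_pos.
  + rewrite tif_pos by trivial. apply (pimp_app _ _ _ IH).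
    open (le_lt_or_eq G _ _ L) as [M|M]; [now rewrite le_SS in M|].
    apply ex_falso, pos_absurd with (1 := Z). apply rem_zero_iff; [now apply pow_pos|].
    now rewrite <- M.
Qed.

Lemma val_of_has_val G n j N e : has_val j e N G -> le G e n -> teq G (tval n (tp j) N) e.
Proof.
intros H L; unfold has_val in H; open H as [R [E D]].
apply val_spec; trivial; [apply p_pos | now apply dvd_intro with R|].
intros f; assume M; assume D'. apply (pneg_app _ _ D).
apply le_elim in M as [z M]. open_dvd D' as [w D'].
apply dvd_intro with (tmul (tpow (tp j) z) w).
apply mul_cancel_l with (tpow (tp j) e); [apply pow_pos, p_pos|].
rewrite <- E, D', M, add_S_l, pow_S, pow_add; nring.
Qed.

Lemma has_val_le G j e N : pos G N -> has_val j e N G -> le G e N.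
Proof.
intros P H; unfold has_val in H; open H as [R [E D]].
apply le_trans with (tpow (tp j) e).
- apply lt_le, lt_pow, prime_ge_2, p_prime.
- apply dvd_le; trivial. now apply dvd_intro with R.
Qed.

(** * Appending an entry to a coded sequence *)

Definition ttop n N := NPrim ptop [n; N].
#[export] Instance ttop_proper G : Proper (teq G ==> teq G ==> teq G) ttop.
Proof. apply NPrim2_proper. Qed.
Lemma top_0 G N : teq G (ttop NZero N) NZero.
Proof. zero_case. Qed.
Lemma top_S G n N : teq G (ttop (NS n) N) (tif (trem N (tp n)) (NS n) (ttop n N)).
Proof. succ_case. Qed.

Lemma top_spec G n N k : dvd G (tp k) N ->
  (forall j, pimp (fun G => lt G k j) (ndvd (tp j) N) G) ->
  lt G k n -> teq G (ttop n N) (NS k).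
Proof.
intros D H. apply (pimp_app (fun G => lt G k n) (fun G => teq G (ttop n N) (NS k))). unfold le.
induct n (Imp (EqN (tsub (NS #1) #0) NZero) (EqN (ttop #0 #2) (NS #1))) (k .: N .: NVar) FVar.
- assume L. apply ex_falso, (lt_le_absurd G k NZero); [exact L | apply le_0].
- intros IH; assume L. rewrite top_S.
  open (lt_S_cases _ _ _ L) as [M|M].
  + rewrite tif_pos; [apply (pimp_app _ _ _ IH), M|].
    apply rem_pos; [apply p_pos|]. exact (pimp_app _ _ _ (H n) M).
  + rewrite tif_zero; [now rewrite M|]. apply rem_zero_iff; [apply p_pos|]. now rewrite <- M.
Qed.

Lemma top_le G n N : le G (ttop n N) n.
Proof.
unfold le. induct n (EqN (tsub (ttop #0 #1) #0) NZero) (N .: NVar) FVar.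
- rewrite top_0; apply le_refl.
- intros IH; rewrite top_S. open (zero_or_pos G (trem N (tp n))) as [Z|Z].
  + rewrite tif_zero by trivial; apply le_refl.
  + rewrite tif_pos by trivial. apply le_trans with n; auto using le_S.
Qed.

Lemma len_unfold G s : teq G (tlen s) (ttop (NS s) (NS s)).
Proof. now apply by_unfolding. Qed.
Lemma entry_unfold G s i : teq G (tentry s i)
  (tsub (tval (NS s) (tp i) (NS s)) (tif (teqb (NS i) (tlen s)) one NZero)).
Proof. now apply by_unfolding. Qed.

Lemma len_le G s : le G (tlen s) (NS s).
Proof. rewrite len_unfold; apply top_le. Qed.

Lemma len_0 G : teq G (tlen NZero) NZero.
Proof.
rewrite len_unfold, top_S, tif_pos; [apply top_0|].
apply rem_pos; [apply p_pos|]. assume D. apply prime_ndvd_one with (2 := D), p_prime.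
Qed.

(** Appends [i] to [s] by the coding formula; all entries of [s], the last one
    included, enter the product with their own exponent, and only the new one
    gets the increment that marks the end. *)
Definition papp : prim 2 :=
  PComp ppred [PComp pmul [PComp pprod [PComp plength [x0]; x0];
    PComp ppow [PComp pnth_prime [PComp plength [x0]]; pS x1]]].
Definition tapp s i := NPrim papp [s; i].
#[export] Instance tapp_proper G : Proper (teq G ==> teq G ==> teq G) tapp.
Proof. apply NPrim2_proper. Qed.

Lemma prod_pos G k s : pos G (tprod k s).
Proof.
induct k (EqN (tprod #0 #1) (NS (tpred (tprod #0 #1)))) (s .: NVar) FVar.
- rewrite prod_0; apply pos_S.
- intros IH; rewrite prod_S. apply mul_pos; trivial. apply pow_pos, p_pos.
Qed.

Lemma app_unfold G s i : teq G (NS (tapp s i))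
  (tmul (tprod (tlen s) s) (tpow (tp (tlen s)) (NS i))).
Proof.
assert (P : pos G (tmul (tprod (tlen s) s) (tpow (tp (tlen s)) (NS i)))).
{ apply mul_pos; [apply prod_pos | apply pow_pos, p_pos]. }
rewrite P. apply NS_proper. now apply by_unfolding.
Qed.

Lemma app_has_val_last G s i : has_val (tlen s) (NS i) (NS (tapp s i)) G.
Proof.
unfold has_val; ret. exists (tprod (tlen s) s); split.
- rewrite app_unfold; nring.
- apply (pimp_app _ _ _ (prod_ndvd G s (tlen s) (tlen s))), le_refl.
Qed.

Lemma app_has_val_lt G s i j : lt G j (tlen s) -> has_val j (tentry s j) (NS (tapp s i)) G.
Proof.
intros L. eapply has_val_proper_imp; [symmetry; apply app_unfold|].
apply has_val_mul_pow; [now apply lt_neq|]. apply (pimp_app _ _ _ (prod_has_val G s j _)), L.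
Qed.

Lemma len_app G s i : teq G (tlen (tapp s i)) (NS (tlen s)).
Proof.
assert (D : dvd G (tp (tlen s)) (NS (tapp s i))).
{ rewrite app_unfold, pow_S. apply dvd_mul_l, dvd_mul_l, dvd_refl. }
rewrite len_unfold; apply top_spec; trivial.
- intros j; assume L.
  eapply ndvd_proper_imp; [symmetry; apply app_unfold|].
  apply ndvd_mul; [apply p_prime| |].
  + apply (pimp_app _ _ _ (prod_ndvd G s j (tlen s))). now apply lt_le.
  + apply ndvd_pow; [apply p_prime|]. now apply p_ndvd_p, lt_neq_sym.
- apply le_trans with (tp (tlen s)); [apply lt_p|]. apply dvd_le; trivial. apply pos_S.
Qed.

Lemma entry_app_last G s i : teq G (tentry (tapp s i) (tlen s)) i.
Proof.
rewrite entry_unfold, (val_of_has_val G _ _ _ (NS i)).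
- rewrite tif_zero; [unfold one; now rewrite sub_SS, sub_0_r|].
  apply eqb_iff. now rewrite len_app.
- apply app_has_val_last.
- apply has_val_le with (tlen s); [apply pos_S | apply app_has_val_last].
Qed.

Lemma entry_app_lt G s i j : lt G j (tlen s) -> teq G (tentry (tapp s i) j) (tentry s j).
Proof.
intros L. rewrite (entry_unfold G (tapp s i)), (val_of_has_val G _ _ _ (tentry s j)).
- rewrite tif_pos; [apply sub_0_r|]. apply pos_intro; assume E. apply (proj1 (eqb_iff _ _ _)) in E.
  rewrite len_app in E. apply NS_inj in E. rewrite E in L. now apply lt_irrefl in L.
- now apply app_has_val_lt.
- apply has_val_le with j; [apply pos_S | now apply app_has_val_lt].
Qed.

(** * Functions of BIM *)

Notation tK t := (NApp (FConst CK) t).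
Notation tL t := (NApp (FConst CL) t).

Lemma K_J G a b : teq G (tK (NJ a b)) a.
Proof. exact (sem_axiom _ G ax_KJ a b). Qed.
Lemma L_J G a b : teq G (tL (NJ a b)) b.
Proof. exact (sem_axiom _ G ax_LJ a b). Qed.

(** [F] is the graph of a function of the second sort. *)
Definition func (F : nterm -> nterm) : wprop := fun G =>
  cov (fun G => exists f, forall x, teq G (NApp f x) (F x)) G.
#[export] Instance mono_func F : Mono (fun G => func F G).
Proof. apply mono_cov. Qed.
#[export] Instance local_func F : Local (fun G => func F G).
Proof. apply local_cov. Qed.

Lemma func_intro G f (F : nterm -> nterm) : (forall x, teq G (NApp f x) (F x)) -> func F G.
Proof. intros H; unfold func; ret; now exists f. Qed.

Tactic Notation "open_func" constr(H) "as" simple_intropattern(p) :=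
  let H' := fresh in pose proof H as H'; unfold func in H'; open H' as p.

Lemma func_id G : func (fun x => x) G.
Proof. apply func_intro with (FConst CId). exact (sem_axiom _ G ax_Id). Qed.

Lemma comp_function G f g : cov (fun G => exists h, forall x,
  teq G (NApp h x) (NApp f (NApp g x))) G.
Proof. exact (sem_axiom _ G ax_comp f g). Qed.

Lemma pair_function G f g : cov (fun G => exists h, forall x,
  teq G (NApp h x) (NJ (NApp f x) (NApp g x))) G.
Proof. exact (sem_axiom _ G ax_pair f g). Qed.

Lemma func_app G f F : func F G -> func (fun x => NApp f (F x)) G.
Proof.
intros H; open_func H as [g Hg].
open (comp_function G f g) as [h Hh]. apply func_intro with h.
intros x; rewrite <- Hg. exact (Hh x).
Qed.

Lemma func_pair G F F' : func F G -> func F' G -> func (fun x => NJ (F x) (F' x)) G.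
Proof.
intros H H'; open_func H as [f Hf]; open_func H' as [g Hg].
open (pair_function G f g) as [h Hh]. apply func_intro with h.
intros x; rewrite <- Hf, <- Hg. exact (Hh x).
Qed.

Lemma func_comp G F F' : func F G -> func F' G -> func (fun x => F (F' x)) G.
Proof.
intros H H'; open_func H as [f Hf]. open_func (func_app G f _ H') as [g Hg].
apply func_intro with g. intros x; now rewrite <- Hf.
Qed.

Lemma func_const G c : func (fun _ => c) G.
Proof.
unfold func.
induct c (ExF (AllN (EqN (NApp $0 #0) #1))) NVar FVar.
- ret; exists (FConst CZero). exact (sem_axiom _ G ax_zero).
- intros H; open H as [f Hf]. fold (func (fun _ => NS c) G).
  open (comp_function G (FConst CSucc) f) as [g Hg]. apply func_intro with g.
  intros x; rewrite Hg. now apply NS_proper.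
Qed.

Lemma func_cong G F a b : func F G -> teq G a b -> teq G (F a) (F b).
Proof. intros H E; open_func H as [f Hf]. now rewrite <- !Hf, E. Qed.

Lemma rec_function G f g : cov (fun G => exists h, forall x n,
  teq G (NApp h (NJ x NZero)) (NApp f x) /\
  teq G (NApp h (NJ x (NS n))) (NApp g (NJ (NJ x n) (NApp h (NJ x n))))) G.
Proof. exact (sem_axiom _ G ax_rec f g). Qed.

Definition vapp {k} (Fs : Vector.t (nterm -> nterm) k) (x : nterm) : Vector.t nterm k :=
  Vector.map (fun F => F x) Fs.

Lemma vapp_cong G {k} (Fs : Vector.t (nterm -> nterm) k) a b :
  vall (fun F => func F G) Fs -> teq G a b -> veq G (vapp Fs a) (vapp Fs b).
Proof.
intros H E; induction Fs as [|F k Fs IH]; cbn; auto. destruct H as [HF H].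
split; auto. now apply func_cong.
Qed.

#[export] Instance mono_vall {X} (P : X -> wprop) {k} (v : Vector.t X k) :
  (forall x, Mono (fun G => P x G)) -> Mono (fun G => vall (fun x => P x G) v).
Proof. intros M G G' I; apply vall_impl. intros x; now apply (M x). Qed.

Lemma veq_cons G t u {k} (ts us : Vector.t nterm k) :
  teq G t u -> veq G ts us -> veq G (t :: ts)%vector (u :: us)%vector.
Proof. now split. Qed.
(** Every primitive recursive combination of functions is a function. The
    recursion axiom of BIM has one parameter and one step function, and pairing
    supplies the arguments of [h] from the triple that the step receives. *)
Lemma func_prim k (p : prim k) : forall G Fs,
  vall (fun F => func F G) Fs -> func (fun x => NPrim p (vapp Fs x)) G.
Proof.
assert (ext : forall G F F', func F G -> (forall x, teq G (F x) (F' x)) -> func F' G).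
{ intros G F F' H E; open_func H as [f Hf]; apply func_intro with f; intros x.
  now rewrite Hf. }
induction p as [k | | k i | k m g fs IHg IHfs | k g h IHg IHh] using prim_nested_rect;
  intros G Fs HFs.
- apply ext with (fun _ => NZero); [apply func_const|]. intros x; symmetry; apply Ax; constructor.
- rewrite (Vector.eta Fs) in *. destruct HFs as [HF _].
  apply (ext _ _ _ (func_app G (FConst CSucc) _ HF)). intros x; symmetry.
  generalize (Vector.tl Fs). apply Vector.case0. apply Ax; constructor.
- apply ext with (Vector.nth Fs i).
  + induction i as [k | k i IH]; revert HFs; apply (Vector.caseS' Fs); intros F Fs'; cbn; intuition.
  + intros x; symmetry. rewrite (red_sound G (PProj i)); cbn. unfold vapp.
    now rewrite (Vector.nth_map _ _ _ _ eq_refl).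
- apply ext with (fun x => NPrim g (vapp (Vector.map (fun f x => NPrim f (vapp Fs x)) fs) x)).
  + apply IHg. clear g IHg. induction fs as [|f m fs IH]; cbn in *; auto.
    destruct IHfs as [Hf Hfs]; auto.
  + intros x; symmetry. unfold vapp at 2; rewrite Vector.map_map. apply Ax; constructor.
- revert HFs; apply (Vector.caseS' Fs); clear Fs; intros F0 Fs [H0 HFs].
  assert (HA := IHg G Fs HFs). cbv beta in HA.
  assert (HB : func (fun y => NPrim h (tL (tK y) :: tL y :: vapp Fs (tK (tK y)))%vector) G).
  { apply ext with (fun y => NPrim h (vapp
      ((fun y => tL (tK y)) :: (fun y => tL y) :: Vector.map (fun F y => F (tK (tK y))) Fs)%vector y)).
    - apply IHh; cbn; split; [|split]; auto using func_app, func_id.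
      clear - HFs. induction Fs as [|F k Fs IH]; cbn in *; auto.
      split; [|apply IH; tauto]. apply (func_comp G F (fun y => tK (tK y))); [tauto|].
      auto using func_app, func_id.
    - intros y; cbn. unfold vapp; rewrite Vector.map_map; reflexivity. }
  open_func HA as [a Ha]. open_func HB as [b Hb].
  open (rec_function G a b) as [r Hr].
  assert (Hp : forall x n, teq G (NApp r (NJ x n)) (NPrim (PRec g h) (n :: vapp Fs x)%vector)).
  { intros x n.
    assert (E : forall (ts : Vector.t nterm k) t,
      Vector.map (nsubst (t .: NVar) FVar) (Vector.map nshift ts) = ts).
    { intros ts t; rewrite Vector.map_map. apply map_id_vall, vall_true.
      intros u; now rewrite nsubst_shift, nsubst_id. }
    enough (S : sem (EqN (NApp r (NJ (nshift x) #0))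
        (NPrim (PRec g h) (#0 :: Vector.map nshift (vapp Fs x))%vector)) (n .: NVar) FVar G).
    { cbn in S. rewrite E, nsubst_shift, nsubst_id in S. now destruct r. }
    assert (step : forall G', incl G G' -> forall n,
       teq G' (NApp r (NJ x n)) (NPrim (PRec g h) (n :: vapp Fs x)%vector) ->
       teq G' (NApp r (NJ x (NS n))) (NPrim (PRec g h) (NS n :: vapp Fs x)%vector)).
    { clear n; intros G' I n IH. clear IHg IHh ext. lift_hyps G G' I.
      rewrite (proj2 (Hr x n)), Hb, rec_succ. apply NPrim_cong.
      apply veq_cons; [now rewrite K_J, L_J|]. apply veq_cons; [now rewrite L_J|].
      apply vapp_cong; trivial. now rewrite !K_J. }
    apply sem_ind.
    - cbn. rewrite E, nsubst_shift, nsubst_id.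
      transitivity (NApp r (NJ x NZero)); [now destruct r|].
      rewrite (proj1 (Hr x NZero)), Ha, rec_zero. reflexivity.
    - intros G' t I H. cbn in *. rewrite E, nsubst_shift, nsubst_id in *.
      assert (R : fsubst FVar r = r) by now destruct r. rewrite R in *. now apply step. }
  apply ext with (fun x => NApp r (NJ x (F0 x))).
  + apply func_app, func_pair; trivial. apply func_id.
  + intros x; apply Hp.
Qed.

(** Comprehension for terms: the source of all functions below. *)
Lemma func_term G t r s : func (fun x => nsubst (x .: r) s t) G.
Proof.
induction t as [[|i] | | f t IH | t u IHt IHu | k p ts IH] using nterm_nested_ind; cbn.
- apply func_id.
- apply func_const.
- apply func_const.
- now apply func_app.
- now apply func_pair.
- assert (H := func_prim k p G (Vector.map (fun u x => nsubst (x .: r) s u) ts)).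
  unfold vapp in H.
  replace (fun x => NPrim p (Vector.map (nsubst (x .: r) s) ts))
    with (fun x => NPrim p (Vector.map (fun F : nterm -> nterm => F x)
      (Vector.map (fun u x => nsubst (x .: r) s u) ts))).
  + apply H. clear -IH. induction ts as [|t k ts IHts]; cbn in *; intuition.
  + extensionality x; now rewrite Vector.map_map.
Qed.

(** [b] vanishes at (x, n) exactly if [g] vanishes at (x, p) for some [p < n]:
    bounded existence as a function. *)
Definition searches (G : world) (g b : fterm) : Prop := forall x n,
  pimp (fun G => teq G (NApp b (NJ x n)) NZero)
    (cov (fun G => exists p, lt G p n /\ teq G (NApp g (NJ x p)) NZero)) G /\
  (forall p, pimp (fun G => lt G p n) (pimp (fun G => teq G (NApp g (NJ x p)) NZero)
     (fun G => teq G (NApp b (NJ x n)) NZero)) G).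

(** The product of the values of [g] below the bound has this property. *)
Lemma search_function G g : cov (fun G => exists b, searches G g b) G.
Proof.
assert (F1 : func (fun _ => one) G) by apply func_const.
assert (F2 : func (fun y => tmul (tL y) (NApp g (tK y))) G)
  by exact (func_term G (tmul (tL #0) (NApp $0 (tK #0))) NVar (g .: FVar)).
open_func F1 as [f1 H1]. open_func F2 as [f2 H2].
open (rec_function G f1 f2) as [b Hb]. ret; exists b.
assert (B0 : forall x, teq G (NApp b (NJ x NZero)) one).
{ intros x; rewrite (proj1 (Hb x NZero)); apply H1. }
assert (BS : forall x n, teq G (NApp b (NJ x (NS n)))
  (tmul (NApp b (NJ x n)) (NApp g (NJ x n)))).
{ intros x n; rewrite (proj2 (Hb x n)), H2, L_J, K_J. reflexivity. }
clear F1 F2 f1 f2 H1 H2 Hb. intros x n; split.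
- unfold le.
  induct n (Imp (EqN (NApp $0 (NJ #1 #0)) NZero)
    (ExN (And (EqN (tsub (NS #0) #1) NZero) (EqN (NApp $1 (NJ #2 #0)) NZero))))
    (x .: NVar) (b .: g .: FVar).
  + assume H. rewrite B0 in H. apply cov_absurd, NS_neq_0 with NZero, H.
  + intros IH; assume H. rewrite BS in H.
    open (zero_or_pos G (NApp b (NJ x n))) as [Z|Z].
    * open (pimp_app _ _ _ IH Z) as [p [Lp Hp]]. ret; exists p; split; trivial.
      apply le_trans with n; auto using le_S.
    * apply mul_eq_0 in H; trivial. ret; exists n; split; trivial. apply le_refl.
- intros p; unfold le.
  induct n (Imp (EqN (tsub (NS #1) #0) NZero) (Imp (EqN (NApp $1 (NJ #2 #1)) NZero)
     (EqN (NApp $0 (NJ #2 #0)) NZero)))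
    (p .: x .: NVar) (b .: g .: FVar).
  + assume H. assume _. apply ex_falso, (lt_le_absurd G p NZero); [exact H | apply le_0].
  + intros IH; assume H; assume E. rewrite BS.
    open (lt_S_cases _ _ _ H) as [M|M].
    * rewrite (pimp_app _ _ _ (pimp_app _ _ _ IH M) E). apply mul_0_l.
    * rewrite <- M, E. apply mul_0_r.
Qed.

(** The order atom of the language. *)
Notation Lt_in G x t := (teq G (NPrim plt [x; t]) NZero).

(** The forcing of [IsInit]. *)
Definition isinit (G : world) s f t : Prop :=
  teq G (tlen s) t /\
  forall x, pimp (fun G => Lt_in G x t) (fun G => teq G (tentry s x) (NApp f x)) G.
#[export] Instance mono_isinit s f t : Mono (fun G => isinit G s f t).
Proof. unfold isinit; exact _. Qed.

Lemma isinit_entry G s f t x : isinit G s f t -> lt G x t -> teq G (tentry s x) (NApp f x).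
Proof. intros [_ H] Lx. apply (pimp_app _ _ _ (H x)). now apply Lt_iff. Qed.

Lemma isinit_0 G f : isinit G NZero f NZero.
Proof.
split; [apply len_0|]. intros x; assume H. apply (proj1 (Lt_iff _ _ _)) in H.
apply ex_falso, (lt_le_absurd G x NZero); [exact H | apply le_0].
Qed.

Lemma isinit_app G s f n : isinit G s f n -> isinit G (tapp s (NApp f n)) f (NS n).
Proof.
intros H; split; [now rewrite len_app, (proj1 H)|].
intros x; assume X. apply (proj1 (Lt_iff _ _ _)) in X.
assert (E := proj1 H). open (lt_S_cases _ _ _ X) as [M|M].
- rewrite entry_app_lt by now rewrite E. now apply isinit_entry with n.
- rewrite M at 1. rewrite <- E at 2. rewrite entry_app_last. now rewrite M.
Qed.

Lemma isinit_proper_imp G s s' f n : teq G s s' -> isinit G s f n -> isinit G s' f n.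
Proof.
intros E [H H']; split; [now rewrite <- E|].
intros x; assume X. rewrite <- E. exact (pimp_app _ _ _ (H' x) X).
Qed.

Lemma isinit_exists G f n : cov (fun G => exists s, isinit G s f n) G.
Proof.
unfold isinit.
induct n (ExN (And (EqN (tlen #0) #1)
   (AllN (Imp (Lt #0 #2) (EqN (tentry #1 #0) (NApp $0 #0)))))) NVar (f .: FVar).
- ret; exists NZero; apply isinit_0.
- intros IH; open IH as [s Hs]. ret; exists (tapp s (NApp f n)). now apply isinit_app.
Qed.

(** * Weak Koenig's lemma implies separation *)

Lemma one_sub_zero G v : teq G v NZero -> teq G (tsub one v) one.
Proof. intros ->; apply sub_0_r. Qed.
Lemma one_sub_pos G v : pos G v -> teq G (tsub one v) NZero.
Proof. intros ->; unfold one; now rewrite sub_SS, sub_0_l. Qed.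
Lemma zero_of_pos_sub G v : pos G (tsub one v) -> teq G v NZero.
Proof.
intros H; open (zero_or_pos G v) as [Z|Z]; trivial.
apply ex_falso, pos_absurd with (1 := H). now apply one_sub_pos.
Qed.
Lemma pos_of_zero_sub G v : teq G (tsub one v) NZero -> pos G v.
Proof.
intros H; open (zero_or_pos G v) as [Z|Z]; trivial.
rewrite one_sub_zero in H by trivial. now apply ex_falso, NS_neq_0 with NZero.
Qed.
Lemma one_sub_cases G v : cov (fun G => teq G (tsub one v) NZero \/ teq G (tsub one v) one) G.
Proof.
open (zero_or_pos G v) as [Z|Z]; ret.
- right; now apply one_sub_zero.
- left; now apply one_sub_pos.
Qed.
Lemma one_sub_lt_2 G v : Lt_in G (tsub one v) Two.
Proof.
apply Lt_iff. open (one_sub_cases G v) as [E|E]; rewrite E.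
- apply le_SS, le_0.
- apply le_refl.
Qed.

Lemma lt_2_cases G i : Lt_in G i Two -> cov (fun G => teq G i NZero \/ teq G i one) G.
Proof.
intros H. apply (proj1 (Lt_iff _ _ _)) in H. open (lt_S_cases _ _ _ H) as [E|E].
- open (lt_S_cases _ _ _ E) as [F|F]; [|ret; now left].
  apply cov_absurd, (lt_le_absurd G i NZero); trivial. apply le_0.
- ret; now right.
Qed.

Definition inE (G : world) f t : Prop := cov (fun G => exists p, teq G (NApp f p) (NS t)) G.
Definition cantor (G : world) f : Prop := forall x, Lt_in G (NApp f x) Two.
#[export] Instance mono_cantor f : Mono (fun G => cantor G f).
Proof. unfold cantor; exact _. Qed.

(** The decidable set to which the lemma is applied: the sequences [s] seen to
    run into the enumerated set before stage length(s). If a(p) enumerates a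
    pair then its first component m is read off from a(p), so that only p has
    to be searched for. *)
Lemma seen_function G a : cov (fun G => exists b,
  forall s, (pimp (fun G => pos G (NApp b s))
    (cov (fun G => exists p m, lt G p (tlen s) /\ lt G m (tlen s) /\
                   teq G (NApp a p) (NS (NJ m (tentry s m))))) G) /\
  (pimp (fun G => teq G (NApp b s) NZero) (fun G => forall p m, pimp (fun G =>
     lt G p (tlen s) /\ lt G m (tlen s) /\
                   teq G (NApp a p) (NS (NJ m (tentry s m)))) absurd G)) G) G.
Proof.
set (m := fun p => tK (tpred (NApp a p))).
assert (F1 : func (fun y => tadd (teqb (NApp a (tL y)) (NS (NJ (m (tL y)) (tentry (tK y) (m (tL y))))))
      (tsub (NS (m (tL y))) (tlen (tK y)))) G).
{ exact (func_term G (tadd (teqb (NApp $0 (tL #0)) (NS (NJ (tK (tpred (NApp $0 (tL #0))))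
      (tentry (tK #0) (tK (tpred (NApp $0 (tL #0))))))))
      (tsub (NS (tK (tpred (NApp $0 (tL #0))))) (tlen (tK #0)))) NVar (a .: FVar)). }
open_func F1 as [c Hc]. open (search_function G c) as [b1 H1].
assert (F2 : func (fun s => tsub one (NApp b1 (NJ s (tlen s)))) G).
{ exact (func_term G (tsub one (NApp $0 (NJ #0 (tlen #0)))) NVar (b1 .: FVar)). }
open_func F2 as [b Hb]. ret; exists b. clear F1 F2.
assert (Hc' : forall s p, teq G (NApp c (NJ s p))
  (tadd (teqb (NApp a p) (NS (NJ (m p) (tentry s (m p))))) (tsub (NS (m p)) (tlen s)))).
{ intros s p. rewrite Hc. unfold m. now rewrite L_J, K_J. }
clear Hc. intros s; split.
- assume P. rewrite Hb in P. apply zero_of_pos_sub in P.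
  open (pimp_app _ _ _ (proj1 (H1 s (tlen s))) P) as [p [Lp Hp]].
  rewrite Hc' in Hp. ret; exists p, (m p). split; [|split]; trivial.
  + now apply add_eq_0_r in Hp.
  + apply eqb_iff. now apply add_eq_0_l in Hp.
- assume Z. intros p q. assume [Lp [Lq E]]. rewrite Hb in Z. apply pos_of_zero_sub in Z.
  apply pos_absurd with (1 := Z).
  refine (pimp_app _ _ _ (pimp_app _ _ _ (proj2 (H1 s (tlen s)) p) Lp) _). rewrite Hc'.
  assert (M : teq G (m p) q).
  { unfold m. now rewrite E, pred_S, K_J. }
  rewrite M, (Lq : teq _ _ _), add_0_r. now apply eqb_iff.
Qed.

(** The binary sequence that avoids a finite part of that set: 1 at [m] if
    (m, 0) is enumerated before stage [n], else 0. *)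
Lemma guess_function G a n : cov (fun G => exists g,
  cantor G g /\
  forall m, cov (fun G =>
     (teq G (NApp g m) one /\ inE G a (NJ m NZero)) \/
     (teq G (NApp g m) NZero /\ forall p, pimp (fun G => lt G p n)
        (pneg (fun G => teq G (NApp a p) (NS (NJ m NZero)))) G)) G) G.
Proof.
assert (F1 : func (fun y => teqb (NApp a (tL y)) (NS (NJ (tK y) NZero))) G).
{ exact (func_term G (teqb (NApp $0 (tL #0)) (NS (NJ (tK #0) NZero))) NVar (a .: FVar)). }
open_func F1 as [c Hc]. open (search_function G c) as [b1 H1].
assert (F2 : func (fun m => tsub one (NApp b1 (NJ m n))) G).
{ exact (func_term G (tsub one (NApp $0 (NJ #0 #1))) (n .: NVar) (b1 .: FVar)). }
open_func F2 as [g Hg]. ret; exists g. clear F1 F2.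
assert (Hc' : forall m p, teq G (NApp c (NJ m p)) (teqb (NApp a p) (NS (NJ m NZero)))).
{ intros m p. now rewrite Hc, L_J, K_J. }
split.
- intros m. assert (B := one_sub_lt_2 G (NApp b1 (NJ m n))).
  apply Lt_iff. rewrite Hg. now apply Lt_iff.
- intros m. open (zero_or_pos G (NApp b1 (NJ m n))) as [Z|Z].
  + open (pimp_app _ _ _ (proj1 (H1 m n)) Z) as [p [_ Hp]]. ret; left; split.
    * rewrite Hg; now apply one_sub_zero.
    * unfold inE; ret; exists p. rewrite Hc' in Hp. now apply (proj1 (eqb_iff _ _ _)) in Hp.
  + ret; right; split; [rewrite Hg; now apply one_sub_pos|].
    intros p; assume Lp; assume E. apply pos_absurd with (1 := Z).
    refine (pimp_app _ _ _ (pimp_app _ _ _ (proj2 (H1 m n) p) Lp) _).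
    rewrite Hc'. now apply eqb_iff.
Qed.

(** The forcing of BarCantor (Dfin a), WKL and Sigma01_Sep. *)
Definition bar (a : nterm) : wprop := fun G => forall g, pimp (fun G => cantor G g)
  (cov (fun G => exists k, cov (fun G => exists s, isinit G s g k /\
     (Lt_in G s (tlen a) /\ pneg (fun G => teq G (tentry a s) NZero) G)) G)) G.

Definition wkl : wprop := fun G => forall a,
  pimp (fun G => forall n, cov (fun G => exists c, isinit G c a n /\ pneg (bar c) G) G)
  (cov (fun G => exists g, cantor G g /\
     forall n, cov (fun G => exists s, isinit G s g n /\ teq G (NApp a s) NZero) G)) G.

Definition sep : wprop := fun G => forall a,
  pimp (pneg (cov (fun G => exists n, forall i, pimp (fun G => Lt_in G i Two)
     (fun G => inE G a (NJ n i)) G)))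
  (cov (fun G => exists g, forall n, pneg (fun G => inE G a (NJ n (NApp g n))) G)) G.

Theorem wkl_to_sep G : wkl G -> sep G.
Proof.
intros W a. assert (MW : Mono wkl) by (unfold wkl; exact _). assume HA.
assert (Disj : forall n, pimp (fun G => inE G a (NJ n NZero)) (pneg (fun G => inE G a (NJ n one))) G).
{ intros n; assume E0; assume E1. apply (pneg_app _ _ HA). ret; exists n.
  intros i; assume Li. open (lt_2_cases _ _ Li) as [E|E].
  - unfold inE in *. open E0 as [p Hp]. ret; exists p. now rewrite Hp, E.
  - unfold inE in *. open E1 as [p Hp]. ret; exists p. now rewrite Hp, E. }
clear HA. open (seen_function G a) as [b Hb].
assert (HT : forall n, cov (fun G => exists c, isinit G c b n /\ pneg (bar c) G) G).
{ intros n. open (isinit_exists G b n) as [c Hc]. ret; exists c; split; trivial.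
  assume B. open (guess_function G a n) as [g [Cg Hg]].
  open (pimp_app _ _ _ (B g) Cg) as [k B']. open B' as [s [Is [Ls Es]]].
  apply (proj1 (Lt_iff _ _ _)) in Ls. rewrite (proj1 Hc) in Ls.
  assert (P : pos G (NApp b s)).
  { apply pos_intro; assume Z. apply (pneg_app _ _ Es). now rewrite (isinit_entry _ _ _ _ _ Hc Ls). }
  open (pimp_app _ _ _ (proj1 (Hb s)) P) as [p [m [Lp [Lm E]]]].
  rewrite (proj1 Is) in Lm. rewrite (isinit_entry _ _ _ _ _ Is Lm) in E.
  open (Hg m) as [[Eg M]|[Eg M]]; rewrite Eg in E.
  - apply (pneg_app _ _ (pimp_app _ _ _ (Disj m) M)). unfold inE; ret; now exists p.
  - assert (Lpn : lt G p n).
    { apply le_trans with (NS s); trivial. apply le_trans with (tlen s); trivial. apply len_le. }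
    exact (pneg_app _ _ (pimp_app _ _ _ (M p) Lpn) E). }
open (pimp_app _ _ _ (W b) HT) as [g [Cg Hg]]. ret; exists g.
intros n; assume E. unfold inE in E; open E as [p Hp].
open (Hg (NS (tadd n p))) as [s [Is Es]].
assert (Ln : lt G n (tlen s)).
{ rewrite (proj1 Is). apply le_intro with p; nring. }
refine (pimp_app _ _ _ (pimp_app _ _ _ (proj2 (Hb s)) Es p n) _). split; [|split]; trivial.
- rewrite (proj1 Is). apply le_intro with n; nring.
- rewrite (isinit_entry _ _ _ _ n Is); trivial. now rewrite <- (proj1 Is).
Qed.

(** * Binary extensions of a finite sequence *)

(** The digits of [u], from the lowest one, are the bits that [text e s u] appends
    to [s]. Quantifying over the extensions of [s] by [d] bits is then
    quantifying over the numbers below 2^d. *)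
Definition pbit : prim 1 := PRec (PZero 0) (PComp psub [pconst 1; x1]).
Definition phalf : prim 1 := PRec (PZero 0) (PComp padd [x1; PComp pbit [x0]]).
Definition pshr : prim 2 := PRec x0 (PComp phalf [x1]).
Definition pext : prim 3 := PRec x0 (PComp papp [x1; PComp pbit [PComp pshr [x0; x3]]]).
Definition tbit n := NPrim pbit [n].
Definition thalf n := NPrim phalf [n].
Definition tshr e u := NPrim pshr [e; u].
Definition text e s u := NPrim pext [e; s; u].
#[export] Instance tbit_proper G : Proper (teq G ==> teq G) tbit.
Proof. apply NPrim1_proper. Qed.
#[export] Instance thalf_proper G : Proper (teq G ==> teq G) thalf.
Proof. apply NPrim1_proper. Qed.
#[export] Instance tshr_proper G : Proper (teq G ==> teq G ==> teq G) tshr.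
Proof. apply NPrim2_proper. Qed.
#[export] Instance text_proper G : Proper (teq G ==> teq G ==> teq G ==> teq G) text.
Proof. apply NPrim3_proper. Qed.

Lemma bit_0 G : teq G (tbit NZero) NZero.
Proof. zero_case. Qed.
Lemma bit_S G n : teq G (tbit (NS n)) (tsub one (tbit n)).
Proof. succ_case. Qed.
Lemma half_0 G : teq G (thalf NZero) NZero.
Proof. zero_case. Qed.
Lemma half_S G n : teq G (thalf (NS n)) (tadd (thalf n) (tbit n)).
Proof. succ_case. Qed.
Lemma shr_0 G u : teq G (tshr NZero u) u.
Proof. zero_case. Qed.
Lemma shr_S G e u : teq G (tshr (NS e) u) (thalf (tshr e u)).
Proof. succ_case. Qed.
Lemma ext_0 G s u : teq G (text NZero s u) s.
Proof. zero_case. Qed.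
Lemma ext_S G e s u : teq G (text (NS e) s u) (tapp (text e s u) (tbit (tshr e u))).
Proof. succ_case. Qed.

Lemma bit_cases G n : cov (fun G => teq G (tbit n) NZero \/ teq G (tbit n) one) G.
Proof.
induct n (Or (EqN (tbit #0) NZero) (EqN (tbit #0) one)) NVar FVar.
- ret; left; apply bit_0.
- intros _. open (one_sub_cases G (tbit n)) as [E|E]; ret; [left|right]; now rewrite bit_S.
Qed.

Lemma half_bit G n : teq G n (tadd (tadd (thalf n) (thalf n)) (tbit n)).
Proof.
induct n (EqN #0 (tadd (tadd (thalf #0) (thalf #0)) (tbit #0))) NVar FVar.
- rewrite half_0, bit_0; nring.
- intros IH. rewrite half_S, bit_S.
  open (bit_cases G n) as [E|E]; rewrite E in *; rewrite IH at 1.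
  + rewrite one_sub_zero by reflexivity. nring.
  + rewrite one_sub_pos by apply pos_S. nring.
Qed.

Lemma bit_half_double G u : teq G (tbit (tadd u u)) NZero /\ teq G (thalf (tadd u u)) u.
Proof.
induct u (And (EqN (tbit (tadd #0 #0)) NZero) (EqN (thalf (tadd #0 #0)) #0)) NVar FVar.
- now rewrite !add_0_l, bit_0, half_0.
- intros [IB IH].
  assert (E : teq G (tadd (NS u) (NS u)) (NS (NS (tadd u u)))) by nring.
  rewrite !E, half_S, half_S, !bit_S, IB, IH. rewrite (one_sub_zero G NZero) by reflexivity. split.
  + apply one_sub_pos, pos_S.
  + nring.
Qed.

Lemma bit_half_double_S G u : teq G (tbit (NS (tadd u u))) one /\ teq G (thalf (NS (tadd u u))) u.
Proof.
destruct (bit_half_double G u) as [B H]. rewrite bit_S, half_S, B, H, add_0_r.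
split; [apply one_sub_zero|]; reflexivity.
Qed.

Lemma shr_S_half G e u : teq G (tshr (NS e) u) (tshr e (thalf u)).
Proof.
induct e (EqN (tshr (NS #0) #1) (tshr #0 (thalf #1))) (u .: NVar) FVar.
- now rewrite shr_S, !shr_0.
- intros IH. now rewrite shr_S, IH, shr_S.
Qed.

(** The bits may also be appended starting from the root, which is how the
    extensions of [s] relate to those of its children. *)
Lemma ext_S_first G e s u : teq G (text (NS e) s u) (text e (tapp s (tbit u)) (thalf u)).
Proof.
induct e (EqN (text (NS #0) #1 #2) (text #0 (tapp #1 (tbit #2)) (thalf #2)))
  (s .: u .: NVar) FVar.
- now rewrite ext_S, !ext_0, shr_0.
- intros IH. now rewrite ext_S, IH, ext_S, shr_S_half.
Qed.

(** * Bars of bounded depth *)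

Definition barred (a : fterm) (s d : nterm) : wprop := fun G => forall u,
  pimp (fun G => lt G u (tpow Two d))
    (cov (fun G => exists e, lt G e (NS d) /\ pos G (NApp a (text e s u)))) G.

Lemma barred_here G a s d : pos G (NApp a s) -> barred a s d G.
Proof.
intros P u; assume _. ret; exists NZero. rewrite ext_0. split; trivial.
apply le_SS, le_0.
Qed.

Lemma barred_0 G a s : barred a s NZero G -> pos G (NApp a s).
Proof.
intros B. assert (U : lt G NZero (tpow Two NZero)) by (rewrite pow_0; apply le_refl).
open (pimp_app _ _ _ (B NZero) U) as [e [Le P]]. rewrite le_SS in Le.
apply le_0_inv in Le. now rewrite Le, ext_0 in P.
Qed.

#[export] Instance mono_barred a s d : Mono (fun G => barred a s d G).
Proof. unfold barred; exact _. Qed.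

Lemma barred_step G a s d v i u :
  barred a s (NS d) G -> teq G (NApp a s) NZero -> teq G (tbit v) i /\ teq G (thalf v) u ->
  lt G v (tpow Two (NS d)) ->
  cov (fun G => exists e, lt G e (NS d) /\ pos G (NApp a (text e (tapp s i) u))) G.
Proof.
intros B Z [Hi Hu] Lv. open (pimp_app _ _ _ (B v) Lv) as [e [Le P]].
open (zero_or_pos G e) as [Y|Y].
- rewrite Y, ext_0 in P. apply cov_absurd, pos_absurd with (1 := P), Z.
- ret; exists (tpred e). rewrite Y, ext_S_first, Hi, Hu in P. split; trivial.
  now rewrite Y, le_SS in Le.
Qed.

Lemma lt_pow_double G u d : lt G u (tpow Two d) -> lt G (NS (tadd u u)) (tpow Two (NS d)).
Proof.
intros Lu. apply le_elim in Lu as [z Lu]. rewrite pow_S, Lu.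
apply le_intro with (tadd z z). unfold Two; nring.
Qed.

Lemma barred_split G a s d : barred a s (NS d) G ->
  cov (fun G => pos G (NApp a s) \/
    (barred a (tapp s NZero) d G /\ barred a (tapp s one) d G)) G.
Proof.
intros B. open (zero_or_pos G (NApp a s)) as [Z|Z]; [|ret; now left].
ret. right; split; intros u; assume Lu; apply lt_pow_double in Lu.
- refine (barred_step G a s d (tadd u u) _ u B Z (bit_half_double G u) _). now apply lt_le.
- exact (barred_step G a s d (NS (tadd u u)) _ u B Z (bit_half_double_S G u) Lu).
Qed.

Lemma barred_join G a s d : barred a (tapp s NZero) d G -> barred a (tapp s one) d G ->
  barred a s (NS d) G.
Proof.
intros B0 B1 u; assume Lu.
assert (Lh : lt G (thalf u) (tpow Two d)).
{ open (lt_or_le G (thalf u) (tpow Two d)) as [H|H]; trivial.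
  apply ex_falso, lt_le_absurd with (1 := Lu). apply le_elim in H as [z H].
  rewrite (half_bit G u), H, pow_S.
  apply le_intro with (tadd (tadd z z) (tbit u)). unfold Two; nring. }
assert (B : cov (fun G => exists e, lt G e (NS d) /\
   pos G (NApp a (text e (tapp s (tbit u)) (thalf u)))) G).
{ open (bit_cases G u) as [E|E].
  - open (pimp_app _ _ _ (B0 (thalf u)) Lh) as [e [Le P]]. ret; exists e; split; trivial.
    now rewrite E.
  - open (pimp_app _ _ _ (B1 (thalf u)) Lh) as [e [Le P]]. ret; exists e; split; trivial.
    now rewrite E. }
open B as [e [Le P]]. ret; exists (NS e). split; [now rewrite le_SS|].
now rewrite ext_S_first.
Qed.

(** A function [b] that is nonzero exactly at the barred pairs. From here on
    only [b] is used: as an atom it can occur in induction formulas. *)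
Definition decides_barred (G : world) (a b : fterm) : Prop := forall s d,
  pimp (fun G => pos G (NApp b (NJ s d))) (barred a s d) G /\
  pimp (barred a s d) (fun G => pos G (NApp b (NJ s d))) G.

(** A failure of [barred] is a bounded search for [u] such that the bounded
    search for [e] fails. *)
Lemma barred_function G a : cov (fun G => exists b, decides_barred G a b) G.
Proof.
unfold decides_barred.
assert (F1 : func (fun y => tsub one (NApp a (text (tL y) (tK (tK y)) (tL (tK y))))) G).
{ exact (func_term G (tsub one (NApp $0 (text (tL #0) (tK (tK #0)) (tL (tK #0))))) NVar (a .: FVar)). }
open_func F1 as [c Hc]. open (search_function G c) as [h Hh].
assert (F2 : func (fun y => tsub one (NApp h (NJ (NJ (tK (tK y)) (tL y)) (NS (tL (tK y)))))) G).
{ exact (func_term G (tsub one (NApp $0 (NJ (NJ (tK (tK #0)) (tL #0)) (NS (tL (tK #0))))))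
    NVar (h .: FVar)). }
open_func F2 as [c' Hc']. open (search_function G c') as [h' Hh'].
assert (F3 : func (fun y => NApp h' (NJ y (tpow Two (tL y)))) G).
{ exact (func_term G (NApp $0 (NJ #0 (tpow Two (tL #0)))) NVar (h' .: FVar)). }
open_func F3 as [b Hb]. ret; exists b. clear F1 F2 F3.
assert (Ec : forall s u e, teq G (NApp c (NJ (NJ s u) e)) (tsub one (NApp a (text e s u)))).
{ intros s u e. now rewrite Hc, L_J, K_J, K_J, L_J. }
assert (Ec' : forall s d u, teq G (NApp c' (NJ (NJ s d) u))
   (tsub one (NApp h (NJ (NJ s u) (NS d))))).
{ intros s d u. now rewrite Hc', L_J, K_J, K_J, L_J. }
assert (Eb : forall s d, teq G (NApp b (NJ s d)) (NApp h' (NJ (NJ s d) (tpow Two d)))).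
{ intros s d. now rewrite Hb, L_J. }
clear Hc Hc' Hb. intros s d; split.
- assume P. intros u; assume Lu. rewrite Eb in P.
  open (zero_or_pos G (NApp h (NJ (NJ s u) (NS d)))) as [Z|Z].
  + open (pimp_app _ _ _ (proj1 (Hh _ _)) Z) as [e [Le E]]. ret; exists e; split; trivial.
    rewrite Ec in E. now apply pos_of_zero_sub.
  + apply cov_absurd, pos_absurd with (1 := P).
    refine (pimp_app _ _ _ (pimp_app _ _ _ (proj2 (Hh' (NJ s d) _) u) Lu) _).
    rewrite Ec'. now apply one_sub_pos.
- assume B. apply pos_intro; assume Z. rewrite Eb in Z.
  open (pimp_app _ _ _ (proj1 (Hh' _ _)) Z) as [u [Lu E]]. rewrite Ec' in E.
  apply pos_of_zero_sub in E. apply pos_absurd with (1 := E).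
  open (pimp_app _ _ _ (B u) Lu) as [e [Le P]].
  refine (pimp_app _ _ _ (pimp_app _ _ _ (proj2 (Hh (NJ s u) (NS d)) e) Le) _).
  rewrite Ec. now apply one_sub_pos.
Qed.

#[export] Instance mono_decides_barred a b : Mono (fun G => decides_barred G a b).
Proof. unfold decides_barred; exact _. Qed.

Notation bd G b s d := (pos G (NApp b (NJ s d))).

Lemma bd_0 G a b s : decides_barred G a b -> bd G b s NZero -> pos G (NApp a s).
Proof. intros H B. apply barred_0. exact (pimp_app _ _ _ (proj1 (H s _)) B). Qed.

Lemma bd_here G a b s d : decides_barred G a b -> pos G (NApp a s) -> bd G b s d.
Proof. intros H B. apply (pimp_app _ _ _ (proj2 (H s d))). now apply barred_here. Qed.

Lemma bd_split G a b s d : decides_barred G a b -> bd G b s (NS d) ->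
  cov (fun G => pos G (NApp a s) \/ (bd G b (tapp s NZero) d /\ bd G b (tapp s one) d)) G.
Proof.
intros H B. apply (pimp_app _ _ _ (proj1 (H s _))) in B.
open (barred_split _ _ _ _ B) as [P|[B0 B1]]; ret; [now left|right].
split; [apply (pimp_app _ _ _ (proj2 (H _ d))), B0 | apply (pimp_app _ _ _ (proj2 (H _ d))), B1].
Qed.

Lemma bd_join G a b s d : decides_barred G a b ->
  bd G b (tapp s NZero) d -> bd G b (tapp s one) d -> bd G b s (NS d).
Proof.
intros H B0 B1. apply (pimp_app _ _ _ (proj2 (H s _))), barred_join;
 [exact (pimp_app _ _ _ (proj1 (H _ d)) B0) | exact (pimp_app _ _ _ (proj1 (H _ d)) B1)].
Qed.

Lemma bd_S G a b d : decides_barred G a b -> forall s,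
  pimp (fun G => bd G b s d) (fun G => bd G b s (NS d)) G.
Proof.
intros H.
induct d (AllN (Imp (EqN (NApp $0 (NJ #0 #1)) (NS (tpred (NApp $0 (NJ #0 #1)))))
  (EqN (NApp $0 (NJ #0 (NS #1))) (NS (tpred (NApp $0 (NJ #0 (NS #1))))))))
  NVar (b .: FVar).
- intros s; assume B. apply (bd_here G a); trivial. now apply (bd_0 G a b).
- intros IH s; assume B. open (bd_split _ _ _ _ _ H B) as [P|[B0 B1]].
  + now apply (bd_here G a).
  + apply (bd_join G a); trivial.
    * exact (pimp_app _ _ _ (IH _) B0).
    * exact (pimp_app _ _ _ (IH _) B1).
Qed.

Lemma bd_add G a b s d z : decides_barred G a b -> bd G b s d -> bd G b s (tadd d z).
Proof.
intros H B. induct z (EqN (NApp $0 (NJ #1 (tadd #2 #0)))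
   (NS (tpred (NApp $0 (NJ #1 (tadd #2 #0)))))) (s .: d .: NVar) (b .: FVar).
- now rewrite add_0_r.
- intros IH. rewrite add_S_r. exact (pimp_app _ _ _ (bd_S _ _ _ _ H s) IH).
Qed.

Lemma bd_le G a b s d d' : decides_barred G a b -> le G d d' -> bd G b s d -> bd G b s d'.
Proof.
intros H Ld B; apply le_elim in Ld as [z E]. rewrite E. now apply (bd_add G a).
Qed.

(** Compactness: paths through a barred [s] meet [a] at codes below a common
    bound [N]; it is the sum of the bounds of the two children, and s + 1 if
    [s] itself is hit. *)
Lemma bd_bound G a b d : decides_barred G a b -> forall s,
  pimp (fun G => bd G b s d) (cov (fun G => exists N, forall g, pimp (fun G => cantor G g)
    (fun G => forall k, pimp (fun G => isinit G s g k) (cov (fun G => exists k', cov (fun G =>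
      exists t, isinit G t g k' /\ Lt_in G t N /\ pos G (NApp a t)) G)) G) G)) G.
Proof.
intros H. unfold isinit, cantor.
induct d (AllN (Imp (EqN (NApp $0 (NJ #0 #1)) (NS (tpred (NApp $0 (NJ #0 #1)))))
  (ExN (AllF (Imp (InCantor $0) (AllN (Imp (IsInit #2 $0 #0)
     (ExN (ExN (And (IsInit #0 $0 #1) (And (Lt #0 #3)
        (EqN (NApp $2 #0) (NS (tpred (NApp $2 #0))))))))))))))) NVar (b .: a .: FVar).
- intros s; assume B. apply (bd_0 G a) in B; trivial. ret; exists (NS s).
  intros g; assume _. intros k; assume I. ret; exists k. ret; exists s.
  split; [exact I|]. split; trivial. apply Lt_iff, le_refl.
- intros IH s; assume B. open (bd_split _ _ _ _ _ H B) as [P|[B0 B1]].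
  + ret; exists (NS s). intros g; assume _. intros k; assume I. ret; exists k. ret; exists s.
    split; [exact I|]. split; trivial. apply Lt_iff, le_refl.
  + open (pimp_app _ _ _ (IH _) B0) as [N0 H0]. open (pimp_app _ _ _ (IH _) B1) as [N1 H1].
    ret; exists (tadd N0 N1). intros g; assume Cg. intros k; assume I.
    assert (I' := isinit_app _ _ _ _ I).
    open (lt_2_cases _ _ (Cg k)) as [E|E].
    * apply (isinit_proper_imp _ _ (tapp s NZero)) in I'; [|now rewrite E].
      open (pimp_app _ _ _ (pimp_app _ _ _ (H0 g) Cg _) I') as [k' X]. open X as [t [It [LN P]]].
      ret; exists k'. ret; exists t. split; [exact It|]. split; trivial.
      apply Lt_iff. apply le_trans with N0; [now apply Lt_iff|]. now apply le_intro with N1.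
    * apply (isinit_proper_imp _ _ (tapp s one)) in I'; [|now rewrite E].
      open (pimp_app _ _ _ (pimp_app _ _ _ (H1 g) Cg _) I') as [k' X]. open X as [t [It [LN P]]].
      ret; exists k'. ret; exists t. split; [exact It|]. split; trivial.
      apply Lt_iff. apply le_trans with N1; [now apply Lt_iff|].
      apply le_intro with N0; nring.
Qed.

(** * Separation implies weak Koenig's lemma *)

(** The sign of [i]: the separating function may take values above 1, and these
    are read as 1. *)
Definition tsg i := tsub one (tsub one i).
#[export] Instance tsg_proper G : Proper (teq G ==> teq G) tsg.
Proof. intros a b E; unfold tsg; now rewrite E. Qed.

(** The pair (s, i) is enumerated when the child [i] of [s] is seen to be barred at a stage
    at which the other child is not *)
Definition sealed (G : world) b s i d : Prop :=
  bd G b (tapp s (tsg i)) d /\ teq G (NApp b (NJ (tapp s (tsub one i)) d)) NZero.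

Definition sealtest b s i d := tadd (tsub one (NApp b (NJ (tapp s (tsg i)) d)))
  (NApp b (NJ (tapp s (tsub one i)) d)).
#[export] Instance sealtest_proper G b :
  Proper (teq G ==> teq G ==> teq G ==> teq G) (sealtest b).
Proof. intros s s' E i i' E' d d' D; unfold sealtest, tsg; now rewrite E, E', D. Qed.

Lemma sealtest_iff G b s i d : teq G (sealtest b s i d) NZero <-> sealed G b s i d.
Proof.
unfold sealtest, sealed; split.
- intros E; split; [apply pos_of_zero_sub; now apply add_eq_0_l in E | now apply add_eq_0_r in E].
- intros [P Z]. rewrite Z, one_sub_pos by trivial. apply add_0_r.
Qed.

Lemma sealed_function G b : cov (fun G => exists e, forall s i,
  pimp (fun G => inE G e (NJ s i)) (cov (fun G => exists d, sealed G b s i d)) G /\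
  (forall d, pimp (fun G => sealed G b s i d) (fun G => inE G e (NJ s i)) G)) G.
Proof.
assert (F : func (fun y => tif (sealtest b (tK (tK y)) (tL (tK y)) (tL y)) (NS (tK y)) NZero) G).
{ exact (func_term G (tif (sealtest $0 (tK (tK #0)) (tL (tK #0)) (tL #0)) (NS (tK #0)) NZero)
    NVar (b .: FVar)). }
open_func F as [e He]. ret; exists e. clear F. unfold inE.
intros s i; split.
- assume E. open E as [q Hq]. rewrite He in Hq.
  open (zero_or_pos G (sealtest b (tK (tK q)) (tL (tK q)) (tL q))) as [Z|Z].
  + rewrite tif_zero in Hq by trivial. apply NS_inj in Hq. rewrite Hq, K_J, L_J in Z.
    ret; exists (tL q). now apply sealtest_iff.
  + rewrite tif_pos in Hq by trivial. apply cov_absurd, (NS_neq_0 G (NJ s i)). now symmetry.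
- intros d; assume S. apply sealtest_iff in S. ret; exists (NJ (NJ s i) d).
  rewrite He, tif_zero; rewrite !K_J; [reflexivity|]. now rewrite !L_J.
Qed.

(** The two children that [sealed] compares are always the two distinct ones. *)
Lemma sg_cases G i : cov (fun G =>
  teq G (tsg i) NZero /\ teq G (tsub one i) one \/
  teq G (tsg i) one /\ teq G (tsub one i) NZero) G.
Proof.
unfold tsg. open (one_sub_cases G i) as [E|E]; ret; [right|left]; split; trivial; rewrite E.
- now apply one_sub_zero.
- apply one_sub_pos, pos_S.
Qed.

(** [h] gives the codes and [d] the entries of the path that takes at [s] the
    branch [tsg (g s)]. *)
Lemma path_function G g : cov (fun G => exists h d,
  teq G (NApp h NZero) NZero /\
  (forall n, teq G (NApp d n) (tsg (NApp g (NApp h n)))) /\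
  (forall n, teq G (NApp h (NS n)) (tapp (NApp h n) (NApp d n)))) G.
Proof.
assert (F : func (fun y => tapp (tL y) (tsg (NApp g (tL y)))) G).
{ exact (func_term G (tapp (tL #0) (tsg (NApp $0 (tL #0)))) NVar (g .: FVar)). }
open_func F as [f Hf]. open (rec_function G (FConst CZero) f) as [r Hr].
assert (F1 : func (fun n => NApp r (NJ NZero n)) G).
{ exact (func_term G (NApp $0 (NJ NZero #0)) NVar (r .: FVar)). }
open_func F1 as [h Hh].
assert (F2 : func (fun n => tsg (NApp g (NApp h n))) G).
{ exact (func_term G (tsg (NApp $0 (NApp $1 #0))) NVar (g .: h .: FVar)). }
open_func F2 as [d Hd]. ret; exists h, d. split; [|split]; trivial.
- rewrite Hh, (proj1 (Hr NZero NZero)). exact (sem_axiom _ G ax_zero NZero).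
- intros n. rewrite Hd, !Hh, (proj2 (Hr NZero n)), Hf, !L_J. reflexivity.
Qed.

Theorem sep_to_wkl G : sep G -> wkl G.
Proof.
intros S a. assert (MS : Mono sep) by (unfold sep; exact _). assume HA.
open (barred_function G a) as [b Hb].
assert (H0 : forall d, pneg (fun G => bd G b NZero d) G).
{ intros d; assume B. open (pimp_app _ _ _ (bd_bound G a b d Hb NZero) B) as [N HN].
  open (HA N) as [c [Ic Bc]]. apply (pneg_app _ _ Bc). intros g; assume Cg.
  open (pimp_app _ _ _ (pimp_app _ _ _ (HN g) Cg NZero) (isinit_0 G g)) as [k X].
  open X as [t [It [LN P]]]. ret; exists k. ret; exists t. split; trivial.
  apply (proj1 (Lt_iff _ _ _)) in LN. split.
  - apply Lt_iff. now rewrite (proj1 Ic).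
  - assume Z. apply pos_absurd with (1 := P). now rewrite <- (isinit_entry _ _ _ _ _ Ic LN). }
clear HA. open (sealed_function G b) as [e He].
assert (Disj : pneg (cov (fun G => exists n, forall i, pimp (fun G => Lt_in G i Two)
     (fun G => inE G e (NJ n i)) G)) G).
{ assume D. open D as [s Hs].
  assert (D0 : inE G e (NJ s NZero)).
  { apply (pimp_app _ _ _ (Hs _)), Lt_iff. apply le_SS, le_0. }
  assert (D1 : inE G e (NJ s one)).
  { apply (pimp_app _ _ _ (Hs _)), Lt_iff. apply le_refl. }
  open (pimp_app _ _ _ (proj1 (He _ _)) D0) as [d0 [P0 Z0]].
  open (pimp_app _ _ _ (proj1 (He _ _)) D1) as [d1 [P1 Z1]].
  unfold tsg in *.
  rewrite (one_sub_zero G NZero) in * by reflexivity.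
  rewrite (one_sub_pos G one) in * by apply pos_S.
  rewrite (one_sub_zero G NZero) in P1 by reflexivity.
  open (lt_or_le G d0 d1) as [M|M].
  - apply lt_le in M. apply pos_absurd with (2 := Z1). exact (bd_le _ _ _ _ _ _ Hb M P0).
  - apply pos_absurd with (2 := Z0). exact (bd_le _ _ _ _ _ _ Hb M P1). }
open (pimp_app _ _ _ (S e) Disj) as [g Hg]. clear Disj.
open (path_function G g) as [h [d [h0 [Hd hS]]]].
assert (I : forall n, isinit G (NApp h n) d n).
{ intros n. unfold isinit.
  induct n (And (EqN (tlen (NApp $0 #0)) #0)
     (AllN (Imp (Lt #0 #1) (EqN (tentry (NApp $0 #1) #0) (NApp $1 #0)))))
     NVar (h .: d .: FVar).
  - apply isinit_proper_imp with NZero; [now symmetry | apply isinit_0].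
  - intros IH. apply isinit_proper_imp with (tapp (NApp h n) (NApp d n)).
    + symmetry; apply hS.
    + now apply isinit_app. }
assert (NB : forall n z, pneg (fun G => bd G b (NApp h n) z) G).
{ intros n. induct n (AllN (Neg (EqN (NApp $1 (NJ (NApp $0 #1) #0))
       (NS (tpred (NApp $1 (NJ (NApp $0 #1) #0))))))) NVar (h .: b .: FVar).
  - intros z; assume B. rewrite h0 in B. exact (pneg_app _ _ (H0 z) B).
  - intros IH z; assume B. rewrite hS, Hd in B. set (s := NApp h n) in *.
    apply (pneg_app _ _ (Hg s)).
    apply (pimp_app _ _ _ (proj2 (He s (NApp g s)) z)). split; trivial.
    open (zero_or_pos G (NApp b (NJ (tapp s (tsub one (NApp g s))) z))) as [Z|Z]; trivial.
    apply ex_falso, (pneg_app _ _ (IH (NS z))). apply (bd_join G a); trivial.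
    + open (sg_cases G (NApp g s)) as [[E E']|[E E']]; [now rewrite E in B | now rewrite E' in Z].
    + open (sg_cases G (NApp g s)) as [[E E']|[E E']]; [now rewrite E' in Z | now rewrite E in B]. }
ret; exists d; split.
- intros x. assert (Q := one_sub_lt_2 G (tsub one (NApp g (NApp h x)))).
  apply Lt_iff. rewrite Hd. now apply Lt_iff.
- intros n. ret; exists (NApp h n). split; [apply I|].
  open (zero_or_pos G (NApp a (NApp h n))) as [Z|Z]; trivial.
  apply ex_falso, (pneg_app _ _ (NB n NZero)). now apply (bd_here G a).
Qed.

Theorem theorem3p1 : BIM_derives (Iff WKL Sigma01_Sep).
Proof.
apply prv_of_sem; split; intros G _ H.
- exact (wkl_to_sep G H).
- exact (sep_to_wkl G H).
Qed.
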